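(* Let $R$ be a commutative Noetherian ring with identity, let $\mathfrak{a}$ be a principal ideal of $R$ and let $M$ be a weakly Laskerian $R$-module. Then the local cohomology module $H^i_{\mathfrak{a}}(M)$ is $\mathfrak{a}$-weakly cofinite for all $i\geq 0$.
   Context: $H^i_{\mathfrak{a}}(M)=\varinjlim_n \operatorname{Ext}^i_R(R/\mathfrak{a}^n,M)$ is the $i$-th local cohomology module of $M$ with respect to $\mathfrak{a}$. An $R$-module $M$ is weakly Laskerian if $\operatorname{Ass}_R(M/N)$ is a finite set for every submodule $N$ of $M$. An $R$-module $X$ is $\mathfrak{a}$-weakly cofinite if $\operatorname{Supp}_R X\subseteq V(\mathfrak{a})$ (where $V(\mathfrak{a})$ is the set of prime ideals containing $\mathfrak{a}$) and $\operatorname{Ext}^j_R(R/\mathfrak{a},X)$ is weakly Laskerian for all $j\geq 0$. *)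

(* Defs.v *)
From HB Require Import structures.
From mathcomp Require Import all_boot all_order all_algebra ring.
From mathcomp Require Import boolp classical_sets functions cardinality fsbigop.

Set Implicit Arguments.
Unset Strict Implicit.
Unset Printing Implicit Defensive.

Import GRing.Theory.
Local Open Scope classical_set_scope.
Local Open Scope ring_scope.
Local Open Scope quotient_scope.

Definition is_submodule (R : comPzRingType) (M : lmodType R) (N : set M) :=
  N 0 /\ forall (a : R) (x y : M), N x -> N y -> N (a *: x + y).

Record submodule (R : comPzRingType) (M : lmodType R) := Submodule {
  submodule_set :> M -> Prop;
  submoduleP : is_submodule submodule_set }.

(* R^o is R as a module over itself, so its submodules are the ideals of R;
   the unit ideal is included. *)
Definition ideal (R : comPzRingType) := submodule R^o.

Definition mem_submodule (R : comPzRingType) (M : lmodType R)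
  (N : submodule M) : {pred M} := fun x => `[< N x >].

Section SubmodulePred.
Variables (R : comPzRingType) (M : lmodType R) (N : submodule M).

Lemma mem_submoduleE x : (x \in mem_submodule N) = `[< N x >].
Proof. by []. Qed.

Lemma submodule_closed_subproof : subsemimod_closed (mem_submodule N).
Proof.
have [N0 NL] := submoduleP N; apply: GRing.submod_closed_semi.
split=> [|a x y]; first exact/asboolP.
by move=> /asboolP Nx /asboolP Ny; apply/asboolP/NL.
Qed.

HB.instance Definition _ :=
  GRing.isSubmodClosed.Build R M (mem_submodule N) submodule_closed_subproof.

Lemma submodule0 : N 0. Proof. exact: (submoduleP N).1. Qed.

Lemma submoduleD x y : N x -> N y -> N (x + y).
Proof.
by move=> Nx Ny; have := (submoduleP N).2 1 _ _ Nx Ny; rewrite scale1r.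
Qed.

Lemma submoduleZ a x : N x -> N (a *: x).
Proof.
by move=> Nx; have := (submoduleP N).2 a _ _ Nx submodule0; rewrite addr0.
Qed.

End SubmodulePred.

Definition subm (R : comPzRingType) (M : lmodType R) (N : submodule M) :=
  {x : M | x \in mem_submodule N}.

Section SubmoduleModule.
Variables (R : comPzRingType) (M : lmodType R) (N : submodule M).
HB.instance Definition _ := SubChoice.on (subm N).
HB.instance Definition _ := [SubChoice_isSubLmodule of subm N by <:].

Definition to_subm (x : M) (Nx : N x) : subm N := exist _ x (asboolT Nx).

Lemma submP (x : subm N) : N (val x). Proof. exact/asboolP/(valP x). Qed.
End SubmoduleModule.

Definition mquot (R : comPzRingType) (M : lmodType R) (N : submodule M) :=
  {ideal_quot (mem_submodule N : zmodClosed M)}.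

Section QuotientModule.
Variables (R : comPzRingType) (M : lmodType R) (N : submodule M).

HB.instance Definition _ := GRing.Zmodule.on (mquot N).
HB.instance Definition _ := EqQuotient.on (mquot N).

Definition mquot_scale (a : R) := lift_op1 (mquot N) ( *:%R a).

Lemma mquot_eqP (x y : M) : (\pi_(mquot N) x = \pi y) <-> N (x - y).
Proof.
have E := Quotient.idealrBE (mem_submodule N : zmodClosed M) x y.
split=> [/eqP|Nxy]; first by move: E => /= <- /asboolP.
by apply/eqP; move: E => /= <-; apply/asboolP.
Qed.

Lemma pi_mquot_scale a : {morph \pi_(mquot N) : x / a *: x >-> mquot_scale a x}.
Proof.
move=> x; unlock mquot_scale; apply/mquot_eqP; rewrite -scalerBr.
by apply/submoduleZ/mquot_eqP; rewrite reprK.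
Qed.

Lemma mquot_piD : {morph \pi_(mquot N) : x y / x + y >-> x + y}.
Proof. exact: Quotient.pi_add. Qed.

Fact mquot_scaleA a b (x : mquot N) :
  mquot_scale a (mquot_scale b x) = mquot_scale (a * b) x.
Proof. by rewrite -[x]reprK -!pi_mquot_scale scalerA. Qed.

Fact mquot_scale1 : left_id 1 mquot_scale.
Proof. by move=> x; rewrite -[x]reprK -pi_mquot_scale scale1r. Qed.

Fact mquot_scaleDr : right_distributive mquot_scale +%R.
Proof.
move=> a x y; rewrite -[x]reprK -[y]reprK -mquot_piD -!pi_mquot_scale.
by rewrite -mquot_piD scalerDr.
Qed.

Fact mquot_scaleDl (x : mquot N) : {morph mquot_scale^~ x : a b / a + b}.
Proof.
by move=> a b; rewrite -[x]reprK -!pi_mquot_scale -mquot_piD scalerDl.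
Qed.

HB.instance Definition _ := GRing.Zmodule_isLmodule.Build R (mquot N)
  mquot_scaleA mquot_scale1 mquot_scaleDr mquot_scaleDl.

Definition mquot_pi (x : M) : mquot N := \pi x.

Fact mquot_pi_linear : linear mquot_pi.
Proof. by move=> a x y; rewrite /mquot_pi mquot_piD pi_mquot_scale. Qed.

HB.instance Definition _ :=
  GRing.isLinear.Build R M (mquot N) *:%R mquot_pi mquot_pi_linear.

Lemma mquot_piP (x y : M) : mquot_pi x = mquot_pi y <-> N (x - y).
Proof. exact: mquot_eqP. Qed.

Lemma mquot_pi_surj (z : mquot N) : mquot_pi (repr z) = z.
Proof. exact: reprK. Qed.

End QuotientModule.

Section InducedMaps.
Variables (R : comPzRingType) (M M' : lmodType R).
Variables (N : submodule M) (N' : submodule M').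
Variables (f : {linear M -> M'}) (fN : forall x, N x -> N' (f x)).

Definition subm_map (x : subm N) : subm N' := to_subm (fN (submP x)).

Fact subm_map_linear : linear subm_map.
Proof. by move=> a x y; apply: val_inj; rewrite /= !linearP. Qed.

HB.instance Definition _ :=
  GRing.isLinear.Build R (subm N) (subm N') *:%R subm_map subm_map_linear.

Definition mquot_fun (x : mquot N) : mquot N' := mquot_pi N' (f (repr x)).

Lemma mquot_funE x : mquot_fun (mquot_pi N x) = mquot_pi N' (f x).
Proof.
apply/mquot_piP; rewrite -linearB; apply: fN; apply/mquot_piP.
by rewrite mquot_pi_surj.
Qed.

Fact mquot_fun_linear : linear mquot_fun.
Proof.
move=> a x y; rewrite -[x]mquot_pi_surj -[y]mquot_pi_surj -linearP.
by rewrite !mquot_funE !linearP.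
Qed.

Definition mquot_map : {linear mquot N -> mquot N'} :=
  HB.pack_for {linear mquot N -> mquot N'} mquot_fun
    (GRing.isLinear.Build R (mquot N) (mquot N') *:%R mquot_fun
       mquot_fun_linear).

Lemma mquot_mapE x : mquot_map (mquot_pi N x) = mquot_pi N' (f x).
Proof. exact: mquot_funE. Qed.
End InducedMaps.

Section SubmoduleConstructions.
Variables (R : comPzRingType) (M M' : lmodType R).

Fact zero_is_submodule : is_submodule [set 0 : M].
Proof. by split=> // a x y -> ->; rewrite scaler0 addr0. Qed.
Definition zero_submodule := Submodule zero_is_submodule.

Fact full_is_submodule : is_submodule [set: M].
Proof. by []. Qed.
Definition full_submodule := Submodule full_is_submodule.

Fact span_is_submodule (A : set M) :
  is_submodule [set x | forall N : submodule M, A `<=` [set y | N y] -> N x].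
Proof.
split=> [N _|a x y Ax Ay N AN]; first exact: submodule0.
by apply: (submoduleP N).2; [apply: Ax|apply: Ay].
Qed.
Definition span (A : set M) := Submodule (span_is_submodule A).

Fact ker_is_submodule (f : {linear M -> M'}) : is_submodule [set x | f x = 0].
Proof.
split=> [|a x y fx fy] /=; first exact: linear0.
by rewrite linearP fx fy scaler0 addr0.
Qed.
Definition ker f := Submodule (ker_is_submodule f).

Fact im_is_submodule (f : {linear M -> M'}) : is_submodule (range f).
Proof.
split=> [|a _ _ [x _ <-] [y _ <-]]; first by exists 0; rewrite ?linear0.
by exists (a *: x + y); rewrite ?linearP.
Qed.
Definition im f := Submodule (im_is_submodule f).

Fact preim_is_submodule (f : {linear M -> M'}) (N : submodule M') :
  is_submodule [set x | N (f x)].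
Proof.
split=> [|a x y Nx Ny] /=.
  by rewrite linear0; apply: submodule0.
by rewrite linearP; apply: (submoduleP N).2.
Qed.
Definition preim f N := Submodule (preim_is_submodule f N).
End SubmoduleConstructions.

Definition noetherian (R : comPzRingType) :=
  forall I : ideal R, exists2 A : set R^o,
    finite_set A & forall x, I x <-> span A x.

Definition principal_ideal (R : comPzRingType) (I : ideal R) :=
  exists x : R^o, forall y, I y <-> span [set x] y.

Definition ideal_mul (R : comPzRingType) (I J : ideal R) : ideal R :=
  span [set z : R^o | exists x y : R, [/\ I x, J y & z = x * y]].

Fixpoint ideal_pow (R : comPzRingType) (I : ideal R) (n : nat) : ideal R :=
  if n is m.+1 then ideal_mul I (ideal_pow I m) else full_submodule R^o.

Lemma ideal_powS_sub (R : comPzRingType) (I : ideal R) n (x : R^o) :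
  ideal_pow I n.+1 x -> ideal_pow I n (idfun x).
Proof. by apply=> _ [y [z [_ Iz ->]]]; apply: submoduleZ. Qed.

Record spec (R : comPzRingType) := Spec {
  spec_ideal :> submodule R^o;
  spec_proper : ~ spec_ideal (1 : R);
  spec_prime : forall x y : R,
    spec_ideal (x * y) -> spec_ideal x \/ spec_ideal y }.

Lemma spec_ext (R : comPzRingType) (P Q : spec R) :
  (forall x : R, P x <-> Q x) -> P = Q.
Proof.
case: P Q => [[P hP] P1 PM] [[Q hQ] Q1 QM] /= PQ.
have E : P = Q by apply/funext => x; apply/propext.
case: _ / E in hQ Q1 QM {PQ} *.
rewrite (Prop_irrelevance hQ hP) in Q1 QM *.
by rewrite (Prop_irrelevance Q1 P1) (Prop_irrelevance QM PM).
Qed.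

Definition V (R : comPzRingType) (I : ideal R) : set (spec R) :=
  [set P : spec R | forall x, I x -> P x].

Section Localization.
Variables (R : comPzRingType) (P : spec R) (M : lmodType R).

Definition denom := {s : R | `[< ~ P s >]}.
Definition fraction := (M * denom)%type.

Implicit Types (s t u : denom) (p q : fraction).

Fact denom1_subproof : `[< ~ P (1 : R) >].
Proof. exact/asboolP/spec_proper. Qed.
Definition denom1 : denom := exist _ 1 denom1_subproof.

Fact denomM_subproof s t : `[< ~ P (val s * val t) >].
Proof.
apply/asboolP => /spec_prime[].
- by have /asboolP := valP s.
- by have /asboolP := valP t.
Qed.
Definition denomM s t : denom := exist _ (val s * val t) (denomM_subproof s t).

(* x / s = y / t iff u (t x - s y) = 0 for some u outside P *)
Definition fraction_eqv p q : bool :=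
  `[< exists u, val u *: (val q.2 *: p.1 - val p.2 *: q.1) = 0 >].

Lemma fraction_eqvP p q : reflect
  (exists u, (val u * val q.2) *: p.1 = (val u * val p.2) *: q.1)
  (fraction_eqv p q).
Proof.
rewrite /fraction_eqv; apply: (iffP (asboolP _)) => -[u E]; exists u.
  move: E; rewrite scalerBr !scalerA => E.
  by apply/subr0_eq.
by rewrite scalerBr !scalerA E subrr.
Qed.

Fact fraction_eqv_is_equiv : equiv_class_of fraction_eqv.
Proof.
split=> [p|p q|q p r].
- by apply/fraction_eqvP; exists denom1.
- by apply/fraction_eqvP/fraction_eqvP => -[u E]; exists u; rewrite E.
- move=> /fraction_eqvP[u E1] /fraction_eqvP[v E2]; apply/fraction_eqvP.
  exists (denomM (denomM u v) q.2) => /=.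
  have -> : val u * val v * val q.2 * val r.2 *: p.1
          = (val v * val r.2) *: ((val u * val q.2) *: p.1).
    by rewrite scalerA; congr (_ *: _) => /=; ring.
  rewrite E1 scalerA.
  transitivity ((val u * val p.2) *: ((val v * val r.2) *: q.1)).
    by rewrite scalerA; congr (_ *: _) => /=; ring.
  rewrite E2 scalerA; congr (_ *: _) => /=.
  ring.
Qed.

Canonical fraction_eqv_equiv := EquivRelPack fraction_eqv_is_equiv.
Canonical fraction_eqv_encModRel := defaultEncModRel fraction_eqv.

Definition localization := {eq_quot fraction_eqv}.
HB.instance Definition _ := Choice.on localization.
HB.instance Definition _ := EqQuotient.on localization.

Definition frac (x : M) (s : denom) : localization := \pi_(localization) (x, s).

Lemma fracP (x : M) s (y : M) t :
  frac x s = frac y t <->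
  exists u, (val u * val t) *: x = (val u * val s) *: y.
Proof.
split=> [/eqP|E]; first by rewrite eqmodE => /fraction_eqvP.
by apply/eqP; rewrite eqmodE; apply/fraction_eqvP.
Qed.

Lemma frac_repr (z : localization) : frac (repr z).1 (repr z).2 = z.
Proof. by rewrite /frac -surjective_pairing reprK. Qed.

Definition loc_add (z w : localization) : localization :=
  let: (x, s) := (repr z : fraction) in
  let: (y, t) := (repr w : fraction) in
  frac (val t *: x + val s *: y) (denomM s t).
Definition loc_opp (z : localization) := frac (- (repr z).1) (repr z).2.
Definition loc_scale (a : R) (z : localization) :=
  frac (a *: (repr z).1) (repr z).2.
Definition loc_zero := frac 0 denom1.

Lemma loc_addE (x : M) s (y : M) t : loc_add (frac x s) (frac y t) =
  frac (val t *: x + val s *: y) (denomM s t).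
Proof.
rewrite /loc_add; have := frac_repr (frac x s); have := frac_repr (frac y t).
case: (repr _) => y' t'; case: (repr _) => x' s' /= /fracP[v Ev] /fracP[u Eu].
apply/fracP; exists (denomM u v); rewrite !scalerDr !scalerA /=; congr (_ + _).
  transitivity ((val v * val t' * val t) *: ((val u * val s) *: x')).
    by rewrite scalerA; congr (_ *: _) => /=; ring.
  by rewrite Eu scalerA; congr (_ *: _) => /=; ring.
transitivity ((val u * val s' * val s) *: ((val v * val t) *: y')).
  by rewrite scalerA; congr (_ *: _) => /=; ring.
by rewrite Ev scalerA; congr (_ *: _) => /=; ring.
Qed.

Lemma loc_oppE (x : M) s : loc_opp (frac x s) = frac (- x) s.
Proof.
apply/fracP; have /fracP[u Eu] := frac_repr (frac x s).
by exists u; rewrite !scalerN Eu.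
Qed.

Lemma loc_scaleE a (x : M) s : loc_scale a (frac x s) = frac (a *: x) s.
Proof.
apply/fracP; have /fracP[u Eu] := frac_repr (frac x s).
exists u; rewrite !scalerA ![_ * a]mulrC.
by rewrite -[LHS]scalerA -[RHS]scalerA Eu.
Qed.

Fact loc_addA : associative loc_add.
Proof.
move=> z1 z2 z3; rewrite -[z1]frac_repr -[z2]frac_repr -[z3]frac_repr.
rewrite !loc_addE; apply/fracP; exists denom1 => /=.
rewrite !(scalerDr, scalerA) addrA; congr (_ + _ + _);
  congr (_ *: _) => /=; ring.
Qed.

Fact loc_addC : commutative loc_add.
Proof.
move=> z1 z2; rewrite -[z1]frac_repr -[z2]frac_repr !loc_addE.
by apply/fracP; exists denom1; rewrite /= addrC [val (repr z1).2 * _]mulrC.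
Qed.

Fact loc_add0 : left_id loc_zero loc_add.
Proof.
move=> z; rewrite -[z]frac_repr /loc_zero loc_addE.
by apply/fracP; exists denom1; rewrite /= scaler0 add0r scale1r !mul1r.
Qed.

Fact loc_addN : left_inverse loc_zero loc_opp loc_add.
Proof.
move=> z; rewrite -[z]frac_repr loc_oppE loc_addE.
by apply/fracP; exists denom1; rewrite /= scalerN addNr !scaler0.
Qed.

HB.instance Definition _ := GRing.isZmodule.Build localization
  loc_addA loc_addC loc_add0 loc_addN.

Fact loc_scaleA a b z : loc_scale a (loc_scale b z) = loc_scale (a * b) z.
Proof. by rewrite -[z]frac_repr !loc_scaleE scalerA. Qed.

Fact loc_scale1 : left_id 1 loc_scale.
Proof. by move=> z; rewrite -[z]frac_repr loc_scaleE scale1r. Qed.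

Fact loc_scaleDr : right_distributive loc_scale +%R.
Proof.
move=> a z w; rewrite -[z]frac_repr -[w]frac_repr.
rewrite [X in loc_scale a X]loc_addE !loc_scaleE [RHS]loc_addE.
by rewrite scalerDr !scalerA ![a * _]mulrC.
Qed.

Fact loc_scaleDl z : {morph loc_scale^~ z : a b / a + b}.
Proof.
move=> a b; rewrite -[z]frac_repr !loc_scaleE [RHS]loc_addE.
apply/fracP; exists denom1; rewrite /= -scalerDr -scalerDl !scalerA.
by congr (_ *: _) => /=; ring.
Qed.

HB.instance Definition _ := GRing.Zmodule_isLmodule.Build R localization
  loc_scaleA loc_scale1 loc_scaleDr loc_scaleDl.

End Localization.

Definition Supp (R : comPzRingType) (M : lmodType R) : set (spec R) :=
  [set P | exists z : localization P M, z <> 0].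

Definition Ass (R : comPzRingType) (M : lmodType R) : set (spec R) :=
  [set P | exists m : M, forall r : R, P r <-> r *: m = 0].

Definition weakly_laskerian (R : comPzRingType) (M : lmodType R) :=
  forall N : submodule M, finite_set (Ass (mquot N)).

Section Hom.
Variables (R : comPzRingType) (M N : lmodType R).

Fact linear_is_submodule : is_submodule [set f : M -> N | linear f].
Proof.
split=> [a x y|a f g fL gL b x y] /=; first by rewrite /= scaler0 addr0.
rewrite -[LHS]/(a *: f (b *: x + y) + g (b *: x + y)).
rewrite -[RHS]/(b *: (a *: f x + g x) + (a *: f y + g y)).
rewrite fL gL !scalerDr !scalerA [b * a]mulrC addrACA; congr (_ + _).
Qed.

Definition Hom := subm (Submodule linear_is_submodule).
HB.instance Definition _ := GRing.Lmodule.on Hom.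

Definition hom_fun (f : Hom) : M -> N := val f.
HB.instance Definition _ (f : Hom) :=
  GRing.isLinear.Build R M N *:%R (hom_fun f) (submP f).

Definition to_hom (f : {linear M -> N}) : Hom :=
  to_subm (N := Submodule linear_is_submodule) (linearP f).
End Hom.

Section Precomposition.
Variables (R : comPzRingType) (L L' M : lmodType R) (h : {linear L -> L'}).

Definition precomp (f : Hom L' M) : Hom L M := to_hom (hom_fun f \o h).

Fact precomp_linear : linear precomp.
Proof. by move=> a f g; apply: val_inj. Qed.

HB.instance Definition _ :=
  GRing.isLinear.Build R (Hom L' M) (Hom L M) *:%R precomp precomp_linear.
End Precomposition.

Section Free.
Variables (R : comPzRingType) (T : choiceType).

Fact finsupp_is_submodule :
  is_submodule [set c : T -> R^o | finite_set [set t | c t != 0]].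
Proof.
split=> [|a c d cF dF] /=.
  by apply: (sub_finite_set _ (finite_set0 T)) => t /eqP[].
apply: (@sub_finite_set _ _ ([set t | c t != 0] `|` [set t | d t != 0])).
  move=> t /=; apply: contraPP => /not_orP[/negP + /negP].
  rewrite !negbK => /eqP ct /eqP dt; apply/negP; rewrite negbK.
  by rewrite -[X in X == 0]/(a *: c t + d t) ct dt scaler0 addr0.
by rewrite finite_setU.
Qed.

Definition free := subm (Submodule finsupp_is_submodule).
HB.instance Definition _ := GRing.Lmodule.on free.

Fact basis_subproof (t : T) :
  finite_set [set u | (if u == t then 1 else 0 : R^o) != 0].
Proof.
apply: (sub_finite_set _ (finite_set1 t)) => u /=.
by case: (u =P t) => // _ /eqP[].
Qed.

Definition basis (t : T) : free :=
  to_subm (N := Submodule finsupp_is_submodule) (basis_subproof t).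

Section Lift.
Variables (M : lmodType R) (g : T -> M).

Definition free_lift (c : free) : M := \sum_(t \in [set: T]) val c t *: g t.

Lemma free_lift_fset (c : free) (A : set T) :
  finite_set A -> [set t | val c t != 0] `<=` A ->
  free_lift c = \sum_(t \in A) val c t *: g t.
Proof.
move=> Afin cA; apply/esym/fsbig_widen => // t [_ /= At].
have [->|/cA//] := eqVneq (val c t) 0; exact: scale0r.
Qed.

Fact free_lift_linear : linear free_lift.
Proof.
move=> a c d.
pose A := [set t | val c t != 0] `|` [set t | val d t != 0].
have Afin : finite_set A.
  by rewrite finite_setU; split; [exact: (submP c)|exact: (submP d)].
rewrite (free_lift_fset Afin (@subsetUl _ _ _)).
rewrite (free_lift_fset Afin (@subsetUr _ _ _)).
rewrite (@free_lift_fset _ A)//; last first.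
  move=> t /=; apply: contraPP => /not_orP[/negP + /negP].
  rewrite !negbK => /eqP ct /eqP dt; apply/negP; rewrite negbK.
  by rewrite -[X in X == 0]/(a *: val c t + val d t) ct dt scaler0 addr0.
rewrite !fsbig_finite//= scaler_sumr -big_split/=; apply: eq_bigr => t _.
by rewrite scalerA -scalerDl.
Qed.

HB.instance Definition _ :=
  GRing.isLinear.Build R free M *:%R free_lift free_lift_linear.

Lemma free_lift_basis t : free_lift (basis t) = g t.
Proof.
rewrite (@free_lift_fset _ [set t])//; last first.
  by move=> u /=; case: (u =P t) => // _ /eqP[].
by rewrite fsbig_set1/= eqxx scale1r.
Qed.
End Lift.

Lemma free_lift_comp (M M' : lmodType R) (h : {linear M -> M'}) (g : T -> M) c :
  h (free_lift g c) = free_lift (h \o g) c.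
Proof.
have cfin : finite_set [set t | val c t != 0] by exact: (submP c).
rewrite !(@free_lift_fset _ _ c _ cfin)// !fsbig_finite//= linear_sum.
by apply: eq_bigr => t _; rewrite linearZ.
Qed.
End Free.

(* The standard free resolution of N is
     ... -> free (syz 2 N) -> free (syz 1 N) -> free (syz 0 N) -> N -> 0
   where syz 0 N = N, the cover of L is the free module on the underlying set
   of L, mapped onto L by linear extension of the identity, and syz n.+1 N is
   the kernel of the cover of syz n N. It is functorial in N. *)

Definition cover (R : comPzRingType) (L : lmodType R) :
  {linear free R L -> L} := free_lift (T := L) (idfun : L -> L).

Definition cover_map (R : comPzRingType) (L L' : lmodType R)
    (f : {linear L -> L'}) : {linear free R L -> free R L'} :=
  free_lift (T := L) (fun x => basis R (f x)).

Lemma cover_surj (R : comPzRingType) (L : lmodType R) (x : L) :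
  cover L (basis R x) = x.
Proof. exact: free_lift_basis. Qed.

Lemma cover_natural (R : comPzRingType) (L L' : lmodType R)
    (f : {linear L -> L'}) (c : free R L) :
  cover L' (cover_map f c) = f (cover L c).
Proof.
rewrite /cover /cover_map !free_lift_comp; congr (free_lift _ c).
by apply/funext => x /=; rewrite cover_surj.
Qed.

Fixpoint syz (R : comPzRingType) (n : nat) (N : lmodType R) : lmodType R :=
  if n is m.+1 then subm (ker (cover (syz m N))) else N.

Lemma cover_map_ker (R : comPzRingType) (L L' : lmodType R)
    (f : {linear L -> L'}) (c : free R L) :
  ker (cover L) c -> ker (cover L') (cover_map f c).
Proof.
move=> c0; apply: etrans (cover_natural f c) _.
by rewrite (c0 : cover L c = 0) linear0.
Qed.

Fixpoint syz_map (R : comPzRingType) (n : nat) (N N' : lmodType R)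
    (f : {linear N -> N'}) : {linear syz n N -> syz n N'} :=
  if n is m.+1 then subm_map (@cover_map_ker _ _ _ (syz_map m f)) else f.

Definition res_diff (R : comPzRingType) (n : nat) (N : lmodType R) :
    {linear free R (syz n.+1 N) -> free R (syz n N)} :=
  (val : syz n.+1 N -> free R (syz n N)) \o cover (syz n.+1 N).

Lemma res_diff_exact (R : comPzRingType) (n : nat) (N : lmodType R)
    (c : free R (syz n.+1 N)) :
  res_diff n N c = 0 <-> exists d, c = res_diff n.+1 N d.
Proof.
split=> [c0|[d ->]].
  have kc : ker (cover (syz n.+1 N)) c by apply: val_inj.
  by exists (basis R (to_subm kc)); rewrite /res_diff /= cover_surj.
by rewrite -[LHS]/(val (cover _ (val (cover _ d)))) (submP (cover _ d)).
Qed.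

Section Ext.
Variables (R : comPzRingType) (N M : lmodType R).

Definition cochain (n : nat) : lmodType R := Hom (free R (syz n N)) M.

Definition coboundary (n : nat) : {linear cochain n -> cochain n.+1} :=
  precomp (M := M) (res_diff n N).

Definition cocycles (n : nat) : submodule (cochain n) := ker (coboundary n).

Definition coboundaries (n : nat) : submodule (cochain n) :=
  if n is m.+1 then im (coboundary m) else zero_submodule (cochain 0).

Definition exact_cocycles (n : nat) : submodule (subm (cocycles n)) :=
  preim (val : subm (cocycles n) -> cochain n) (coboundaries n).

Definition Ext (n : nat) : lmodType R := mquot (exact_cocycles n).
End Ext.

Section ExtMap.
Variables (R : comPzRingType) (N N' M : lmodType R) (f : {linear N -> N'}).

Definition cochain_map (n : nat) : {linear cochain N' M n -> cochain N M n} :=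
  precomp (M := M) (cover_map (syz_map n f)).

Lemma res_diff_natural n (c : free R (syz n.+1 N)) :
  cover_map (syz_map n f) (res_diff n N c) =
  res_diff n N' (cover_map (syz_map n.+1 f) c).
Proof. by rewrite /res_diff /= cover_natural. Qed.

Lemma coboundary_natural n (g : cochain N' M n) :
  coboundary N M n (cochain_map n g) = cochain_map n.+1 (coboundary N' M n g).
Proof.
apply: val_inj; apply/funext => c /=.
rewrite -[LHS]/(hom_fun g (cover_map (syz_map n f) (res_diff n N c))).
by rewrite res_diff_natural.
Qed.

Lemma cochain_map_cocycles n (g : cochain N' M n) :
  cocycles N' M n g -> cocycles N M n (cochain_map n g).
Proof. by move=> g0; rewrite /= coboundary_natural g0 linear0. Qed.

Lemma cochain_map_coboundaries n (g : cochain N' M n) :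
  coboundaries N' M n g -> coboundaries N M n (cochain_map n g).
Proof.
case: n g => [g -> |n _ [g _ <-]]; first exact: linear0.
by exists (cochain_map n g); rewrite ?coboundary_natural.
Qed.

Definition Ext_map (n : nat) : {linear Ext N' M n -> Ext N M n} :=
  mquot_map (N := exact_cocycles N' M n) (N' := exact_cocycles N M n)
    (f := subm_map (@cochain_map_cocycles n))
    (fun g => @cochain_map_coboundaries n (val g)).
End ExtMap.

Section DirectLimit.
Variables (R : comPzRingType) (X : nat -> lmodType R).

Definition prod_fam := forall n, X n.
HB.instance Definition _ := gen_eqMixin prod_fam.
HB.instance Definition _ := gen_choiceMixin prod_fam.

Definition prod_zero : prod_fam := fun n => 0.
Definition prod_opp (x : prod_fam) : prod_fam := fun n => - x n.
Definition prod_add (x y : prod_fam) : prod_fam := fun n => x n + y n.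
Definition prod_scale (a : R) (x : prod_fam) : prod_fam := fun n => a *: x n.

Lemma prod_ext (x y : prod_fam) : (forall n, x n = y n) -> x = y.
Proof. exact: functional_extensionality_dep. Qed.

Fact prod_addA : associative prod_add.
Proof. by move=> x y z; apply: prod_ext => n; exact: addrA. Qed.
Fact prod_addC : commutative prod_add.
Proof. by move=> x y; apply: prod_ext => n; exact: addrC. Qed.
Fact prod_add0 : left_id prod_zero prod_add.
Proof. by move=> x; apply: prod_ext => n; exact: add0r. Qed.
Fact prod_addN : left_inverse prod_zero prod_opp prod_add.
Proof. by move=> x; apply: prod_ext => n; exact: addNr. Qed.

HB.instance Definition _ := GRing.isZmodule.Build prod_fam
  prod_addA prod_addC prod_add0 prod_addN.

Fact prod_scaleA a b x : prod_scale a (prod_scale b x) = prod_scale (a * b) x.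
Proof. by apply: prod_ext => n; exact: scalerA. Qed.
Fact prod_scale1 : left_id 1 prod_scale.
Proof. by move=> x; apply: prod_ext => n; exact: scale1r. Qed.
Fact prod_scaleDr : right_distributive prod_scale +%R.
Proof. by move=> a x y; apply: prod_ext => n; exact: scalerDr. Qed.
Fact prod_scaleDl x : {morph prod_scale^~ x : a b / a + b}.
Proof. by move=> a b; apply: prod_ext => n; exact: scalerDl. Qed.

HB.instance Definition _ := GRing.Zmodule_isLmodule.Build R prod_fam
  prod_scaleA prod_scale1 prod_scaleDr prod_scaleDl.

Fact direct_sum_is_submodule :
  is_submodule [set x : prod_fam | exists m, forall n, (m <= n)%N -> x n = 0].
Proof.
split=> [|a x y [m xm] [k yk]] /=; first by exists 0%N.
exists (maxn m k) => n; rewrite geq_max => /andP[mn kn].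
by rewrite -[LHS]/(a *: x n + y n) xm // yk // scaler0 addr0.
Qed.

Definition direct_sum := subm (Submodule direct_sum_is_submodule).
HB.instance Definition _ := GRing.Lmodule.on direct_sum.

Fact ds_in_subproof (k : nat) (x : X k) : exists m, forall n, (m <= n)%N ->
  dfwith (fun n => 0 : X n) x n = 0.
Proof.
exists k.+1 => n kn; rewrite dfwith_out //.
by apply: contraTneq kn => ->; rewrite ltnn.
Qed.

Definition ds_in (k : nat) (x : X k) : direct_sum :=
  to_subm (N := Submodule direct_sum_is_submodule) (ds_in_subproof x).

Variable phi : forall n, {linear X n -> X n.+1}.

Definition dirlim : lmodType R :=
  mquot (span [set z : direct_sum |
    exists (n : nat) (x : X n), z = ds_in x - ds_in (phi n x)]).

Definition dirlim_in (n : nat) (x : X n) : dirlim := mquot_pi _ (ds_in x).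

Lemma dirlim_in_compat (n : nat) (x : X n) :
  dirlim_in (phi n x) = dirlim_in x.
Proof.
by apply/esym/mquot_piP => N; apply; exists n, x.
Qed.
End DirectLimit.

Definition pow_proj (R : comPzRingType) (I : ideal R) (n : nat) :
    {linear mquot (ideal_pow I n.+1) -> mquot (ideal_pow I n)} :=
  mquot_map (f := idfun) (@ideal_powS_sub R I n).

Definition local_cohomology (R : comPzRingType) (I : ideal R) (i : nat)
    (M : lmodType R) : lmodType R :=
  dirlim (X := fun n => Ext (mquot (ideal_pow I n)) M i)
    (fun n => Ext_map M (pow_proj I n) i).

Definition weakly_cofinite (R : comPzRingType) (I : ideal R)
    (X : lmodType R) :=
  Supp X `<=` V I /\ forall j, weakly_laskerian (Ext (mquot I) X j).

(* Main.v *)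
(* Write a = (x).  The ascending chain of the annihilators of x^n stops at some
   c, so the inclusion (x^(n+c)) -> (x^n) factors through R.  Hence
   R/x^(n+c) -> R/x^n induces 0 on Ext^i for i >= 2, and H^i_a(M) = 0 there,
   while H^0 is the x-torsion of M and H^1 is the cokernel of M -> M_x.
   Ext^j of a finitely generated module into a weakly Laskerian one is weakly
   Laskerian, which settles i = 0.  On H^1 multiplication by x is onto, and its
   kernel K consists of the classes m/x, so K is a subquotient of M.  As x kills
   Ext^j(R/a, H^1) and H^1 is x-divisible, Ext^j(R/a, K) -> Ext^j(R/a, H^1) is
   onto.

   The standard free resolution is compared with finitely generated ones, and
   with R -> R -> R/x^n, through linear maps that factor through a free module:
   such a map induces another one on first syzygies, and there it extends to
   the free cover, so it acts as 0 on Ext. *)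
From mathcomp Require Import all_boot all_order all_algebra.
From mathcomp Require Import boolp classical_sets functions cardinality fsbigop.
From HB Require Import structures.
Require Import Defs.

Set Implicit Arguments.
Unset Strict Implicit.
Unset Printing Implicit Defensive.

Import GRing.Theory.
Local Open Scope classical_set_scope.
Local Open Scope ring_scope.

Definition linmap (R : comPzRingType) (A B : lmodType R) (f : A -> B)
    (fL : linear f) : {linear A -> B} :=
  HB.pack_for {linear A -> B} f (GRing.isLinear.Build R A B *:%R f fL).

(** * Associated primes and weakly Laskerian modules *)

Section Laskerian.
Variable R : comPzRingType.

(** The associated primes of D / (D \cap N), expressed inside A so that no quotient of a submodule
    has to be formed. *)
Definition ass_mod (A : lmodType R) (D N : submodule A) : set (spec R) :=
  [set P | exists2 m, D m & forall r, P r <-> N (r *: m)].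

Lemma Ass_mquot (A : lmodType R) (N : submodule A) :
  Ass (mquot N) = ass_mod (full_submodule A) N.
Proof.
have E r (m : A) : r *: mquot_pi N m = 0 <-> N (r *: m).
  rewrite -linearZ -(linear0 (mquot_pi N)); split=> [/mquot_piP|Nm].
    by rewrite subr0.
  by apply/mquot_piP; rewrite subr0.
apply/seteqP; split=> P [m].
  by move=> Pm; exists (repr m) => // r; rewrite Pm -E mquot_pi_surj.
by move=> _ Pm; exists (mquot_pi N m) => r; rewrite Pm E.
Qed.

(** The hypotheses make G the graph of a linear surjection from a submodule of A onto B. A submodule
    N of B pulls back along G to N', and a witness b of a prime of B/N is replaced by any a related
    to it, which is a witness of the same prime in A/N'. *)
Lemma weakly_laskerian_subquotient (A B : lmodType R) (G : A -> B -> Prop) :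
    (forall r a b a' b', G a b -> G a' b' -> G (r *: a + a') (r *: b + b')) ->
    (forall b, exists a, G a b) -> (forall b, G 0 b -> b = 0) ->
  weakly_laskerian A -> weakly_laskerian B.
Proof.
move=> GL Gtot G0 wA N.
have G00 : G 0 0.
  have [a Ga] := Gtot 0.
  by have := GL (-1) _ _ _ _ Ga Ga; rewrite scaler0 addr0 scaleN1r addNr.
have N'P : is_submodule [set a | exists2 b, G a b & N b].
  split=> [|r a a' [b Gab Nb] [b' Gab' Nb']].
    by exists 0 => //; apply: submodule0.
  by exists (r *: b + b'); [exact: GL|exact: (submoduleP N).2].
apply: sub_finite_set (wA (Submodule N'P)); rewrite !Ass_mquot => P [b _ Pb].
have [a Gab] := Gtot b; exists a => // r; rewrite Pb.
have Gr : G (r *: a) (r *: b).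
  by have := GL r _ _ _ _ Gab G00; rewrite !addr0.
split=> [Nb|[b' Gb' Nb']]; first by exists (r *: b).
have /G0/subr0_eq <- // : G 0 (b' - r *: b).
have := GL (-1) _ _ _ _ Gr Gb'.
by rewrite !scaleN1r addNr [- _ + b']addrC.
Qed.

Fact sub_cap_is_submodule (A : lmodType R) (D E : submodule A) :
  is_submodule [set x | D x /\ E x].
Proof.
split=> [|r x y [Dx Ex] [Dy Ey]]; first by split; apply: submodule0.
by split; apply: (submoduleP _).2.
Qed.
Definition sub_cap (A : lmodType R) (D E : submodule A) :=
  Submodule (sub_cap_is_submodule D E).

(* D / (D \cap W) is weakly Laskerian. *)
Definition wl_mod (A : lmodType R) (D W : submodule A) :=
  forall N : submodule A, (forall x, D x -> W x -> N x) ->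
    finite_set (ass_mod D N).

Lemma wl_mod_mquot (A : lmodType R) (W : submodule A) :
  wl_mod (full_submodule A) W -> weakly_laskerian (mquot W).
Proof.
move=> wW N.
have WN x : full_submodule A x -> W x -> preim (mquot_pi W) N x.
  move=> _ Wx; have /mquot_piP /= -> : W (x - 0) by rewrite subr0.
  by rewrite linear0; apply: submodule0.
apply: sub_finite_set (wW _ WN); rewrite Ass_mquot => P [z _ Pz].
by exists (repr z) => // r; rewrite Pz /= linearZ /= mquot_pi_surj.
Qed.

(* A prime of A/N is a prime of D \cap ker f when some multiple of its witness
   falls there modulo N, and otherwise f carries it to a prime of B/f(N). *)
Lemma wl_mod_extension (A B : lmodType R) (D W : submodule A)
    (f : {linear A -> B}) :
  weakly_laskerian B -> wl_mod (sub_cap D (ker f)) W -> wl_mod D W.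
Proof.
move=> wB wK N WN.
have fNP : is_submodule [set b | exists a, [/\ D a, N a & f a = b]].
  split=> [|r _ _ [a [Da Na <-]] [b [Db Nb <-]]].
    by exists 0; split; rewrite ?linear0//; apply: submodule0.
  by exists (r *: a + b); split; rewrite ?linearP//; apply: (submoduleP _).2.
apply: (@sub_finite_set _ _
  (ass_mod (sub_cap D (ker f)) N `|` Ass (mquot (Submodule fNP)))); last first.
  rewrite finite_setU; split; last exact: wB.
  by apply: wK => x [Dx _]; apply: WN.
move=> P [m Dm Pm]; have DZ r : D (r *: m) by apply: submoduleZ.
have [[r [rP [a [Da Na fa]]]]|noK] :=
    pselect (exists r, ~ P r /\ Submodule fNP (f (r *: m))).
  left; exists (r *: m - a).
    split=> /=; last by rewrite linearB /= fa subrr.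
    by rewrite -scaleN1r addrC; apply: (submoduleP _).2.
  move=> s; have -> : N (s *: (r *: m - a)) <-> N (s *: (r *: m)).
    have E : s *: (r *: m) = s *: a + s *: (r *: m - a).
      by rewrite -scalerDr [r *: m - a]addrC addrA subrr add0r.
    have E' : s *: (r *: m - a) = - s *: a + s *: (r *: m).
      by rewrite scaleNr scalerBr addrC.
    by split=> H; [rewrite E|rewrite E']; apply: (submoduleP N).2.
  rewrite scalerA -Pm; split=> [Ps|/spec_prime[]//].
  by rewrite mulrC; apply: (submoduleZ (N := P)).
right; rewrite Ass_mquot; exists (f m) => // r; rewrite -linearZ; split.
  by move=> /Pm Nr; exists (r *: m).
by move=> fr; apply: contrapT => rP; apply: noK; exists r.
Qed.

(** D / (D \cap W) is here a quotient of a submodule of B^n; the n maps are peeled off one by one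
    with [wl_mod_extension]. *)
Lemma wl_mod_evals (A B : lmodType R) (n : nat) (fs : nat -> {linear A -> B})
    (D W : submodule A) : weakly_laskerian B ->
    (forall x, D x -> (forall i, (i < n)%N -> fs i x = 0) -> W x) ->
  wl_mod D W.
Proof.
move=> wB; elim: n D => [|n IH] D DW.
  move=> N WN; apply: (sub_finite_set _ (finite_set0 _)) => P [m Dm Pm].
  case: (spec_proper (s := P)); apply/Pm; rewrite scale1r.
  by apply: WN => //; apply: DW.
apply: (wl_mod_extension (f := fs n)) => //; apply: IH => x [Dx fx] fsx.
by apply: DW => // i; rewrite ltnS leq_eqVlt => /predU1P[->//|]; apply: fsx.
Qed.
End Laskerian.

(** * Free modules and finite generation over a Noetherian ring *)

Section FreeModules.
Variable R : comPzRingType.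

Lemma free_eval_linear (T : choiceType) (t : T) :
  linear (fun c : free R T => val c t : R^o).
Proof. by move=> r c d; rewrite linearP. Qed.
Definition free_eval (T : choiceType) (t : T) := linmap (free_eval_linear t).

Lemma free_lift_basisK (T : choiceType) (c : free R T) :
  free_lift (@basis R T) c = c.
Proof.
apply: val_inj; apply/funext => u.
rewrite -[LHS]/(free_eval u (free_lift (@basis R T) c)) free_lift_comp.
rewrite /free_lift -(@fsbig_widen _ _ _ _ [set u])//; last first.
  move=> t [_ /= tu]; rewrite /free_eval /=.
  by case: (u =P t) => [ut|_]; [case: tu|rewrite scaler0].
by rewrite fsbig_set1 /= eqxx [LHS]mulr1.
Qed.

Lemma free_ext (T : choiceType) (M : lmodType R)
    (f g : {linear free R T -> M}) :
  (forall t, f (basis R t) = g (basis R t)) -> forall c, f c = g c.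
Proof.
move=> fg c; rewrite -(free_lift_basisK c).
rewrite (free_lift_comp f) (free_lift_comp g).
by congr (free_lift _ c); apply/funext.
Qed.

Lemma free_projective (T : choiceType) (A B : lmodType R) (p : {linear A -> B})
    (h : {linear free R T -> B}) :
    (forall t, exists a, p a = h (basis R t)) ->
  exists h' : {linear free R T -> A}, forall c, p (h' c) = h c.
Proof.
move=> /choice[g gP]; exists (free_lift g).
apply: (@free_ext _ _ (p \o free_lift g) h) => t /=.
by rewrite free_lift_basis.
Qed.

Lemma cover_onto (X : lmodType R) (x : X) : exists c, cover X c = x.
Proof. by exists (basis R x); rewrite cover_surj. Qed.

Definition fg (A : lmodType R) (N : submodule A) :=
  exists n (g : nat -> A), (forall i, (i < n)%N -> N (g i)) /\
    forall y, N y -> exists c : nat -> R, y = \sum_(i < n) c i *: g i.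

Lemma noetherian_fg : noetherian R -> forall I : ideal R, fg I.
Proof.
move=> nR I; have [A /finite_seqP[s ->] IA] := nR I.
exists (size s), (nth 0 s); split=> [i si|y /IA].
  by apply/IA => N; apply; rewrite /= mem_nth.
have SP : is_submodule [set y : R^o | exists c : nat -> R,
    y = \sum_(i < size s) c i *: (nth 0 s i : R^o)].
  split=> [|r _ _ [c ->] [d ->]].
    by exists (fun=> 0); rewrite big1 // => i _; rewrite scale0r.
  exists (fun i => r * c i + d i); rewrite scaler_sumr -big_split /=.
  by apply: eq_bigr => i _; rewrite scalerDl scalerA.
move=> /(_ (Submodule SP)); apply=> z /= zs.
exists (fun i => if i == index z s then 1 else 0).
have zs' : (index z s < size s)%N by rewrite index_mem.
rewrite (bigD1 (Ordinal zs')) //= eqxx nth_index // scale1r big1 ?addr0 //.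
by move=> i; rewrite -val_eqE /= => /negbTE ->; rewrite scale0r.
Qed.

(** Generators of f(N), lifted to N, are followed by generators of the part of N that f kills. *)
Lemma fg_extension (A B : lmodType R) (f : {linear A -> B}) (N : submodule A)
    (fN : submodule B) :
    (forall y, fN y <-> exists2 x, N x & f x = y) ->
  fg fN -> fg (sub_cap N (ker f)) -> fg N.
Proof.
move=> fNE [n [g [gN gspan]]] [m [h [hN hspan]]].
have /choice[g' g'P] : forall i, exists x, (i < n)%N -> N x /\ f x = g i.
  move=> i; have [/gN/fNE[x Nx fx]|_] := boolP (i < n)%N; last by exists 0.
  by exists x.
exists (n + m)%N, (fun i => if (i < n)%N then g' i else h (i - n)%N).
split=> [i inm|y Ny].
  case: ifPn => [/g'P[]//|]; rewrite -leqNgt => ni.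
  by have /hN[] : (i - n < m)%N by rewrite ltn_subLR.
have [c yc] : exists c : nat -> R, f y = \sum_(i < n) c i *: g i.
  by apply: gspan; apply/fNE; exists y.
have [d yd] : exists d : nat -> R,
    y - \sum_(i < n) c i *: g' i = \sum_(i < m) d i *: h i.
  apply: hspan; split.
    apply: submoduleD => //; rewrite -scaleN1r; apply: submoduleZ.
    elim/big_ind: _ => [|x z|i _]; [exact: submodule0|exact: submoduleD|].
    by apply: submoduleZ; case: (g'P i (ltn_ord i)).
  rewrite /= linearB yc linear_sum /= -sumrB big1 // => i _.
  by rewrite linearZ /= (g'P i (ltn_ord i)).2 subrr.
exists (fun i => if (i < n)%N then c i else d (i - n)%N).
rewrite big_split_ord /=.
rewrite (eq_bigr (fun i : 'I_n => c i *: g' i)); last first.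
  by move=> i _; rewrite /= ltn_ord.
rewrite [X in _ + X](eq_bigr (fun i : 'I_m => d i *: h i)); last first.
  by move=> i _; rewrite /= ltnNge leq_addr /= addKn.
by rewrite -yd addrC subrK.
Qed.

(** N embeds in R^n. The image of N under the last form is an ideal, hence finitely generated, and
    induction handles the kernel. *)
Lemma fg_evals (A : lmodType R) (n : nat) (fs : nat -> {linear A -> R^o})
    (N : submodule A) : noetherian R ->
    (forall x, N x -> (forall i, (i < n)%N -> fs i x = 0) -> x = 0) ->
  fg N.
Proof.
move=> nR; elim: n N => [|n IH] N N0.
  exists 0%N, (fun=> 0); split=> // y Ny; exists (fun=> 0).
  by rewrite big_ord0; apply: N0.
have fNP : is_submodule [set y | exists2 x, N x & fs n x = y].
  split=> [|r _ _ [x Nx <-] [z Nz <-]].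
    by exists 0; rewrite ?linear0 //; apply: submodule0.
  by exists (r *: x + z); rewrite ?linearP //; apply: (submoduleP N).2.
apply: (@fg_extension _ _ (fs n) N (Submodule fNP)) => //.
  exact: noetherian_fg.
apply: IH => x [Nx fx] fsx; apply: N0 => // i.
by rewrite ltnS leq_eqVlt => /predU1P[->//|]; apply: fsx.
Qed.

Lemma fg_sub_free (n : nat) (N : submodule (free R 'I_n)) :
  noetherian R -> fg N.
Proof.
move=> nR.
(* The coordinate forms, continued by 0 for indices outside 'I_n. *)
pose fs i : {linear free R 'I_n -> R^o} :=
  if insub i is Some t then free_eval (t : 'I_n) else \0.
apply: (@fg_evals _ n fs) => // x _ fsx; apply: val_inj; apply/funext => t.
have := fsx t (ltn_ord t); rewrite /fs; case: insubP => [u _ ut|].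
  by have -> : u = t by apply: val_inj.
by rewrite ltn_ord.
Qed.

Lemma fg_onto (L : lmodType R) : fg (full_submodule L) ->
  exists n (p : {linear free R 'I_n -> L}), forall x, exists c, p c = x.
Proof.
move=> [n [g [_ gspan]]]; exists n, (free_lift (fun i : 'I_n => g i)) => x.
have [c ->] := gspan x I; exists (\sum_(i < n) c i *: basis R i).
rewrite linear_sum; apply: eq_bigr => i _.
by rewrite linearZ /= free_lift_basis.
Qed.

Lemma fg_subm (A : lmodType R) (N : submodule A) :
  fg N -> fg (full_submodule (subm N)).
Proof.
move=> [n [g [gN gspan]]].
have /choice[g' g'P] : forall i, exists x : subm N, (i < n)%N -> val x = g i.
  move=> i; have [/gN Ng|_] := boolP (i < n)%N; last by exists 0.
  by exists (to_subm Ng).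
exists n, g'; split=> // y _; have [c yc] := gspan _ (submP y).
exists c; apply: val_inj; rewrite linear_sum yc; apply: eq_bigr => i _.
by rewrite linearZ /= g'P.
Qed.
End FreeModules.

(** * Linear maps that factor through a free module *)

Section StableMaps.
Variable R : comPzRingType.

(* Equivalently, u factors through a free module. *)
Definition stably_zero (X X' : lmodType R) (u : X -> X') :=
  exists v : {linear X -> free R X'}, forall x, cover X' (v x) = u x.

(** Both U and v \o p lift u \o p to the cover of X', so their difference lands in the kernel of
    that cover; on the kernel of p it equals U. *)
Lemma stably_zero_lift (X X' F : lmodType R) (p : {linear F -> X}) (u : X -> X')
    (U : {linear F -> free R X'}) :
    stably_zero u -> (forall c, cover X' (U c) = u (p c)) ->
  exists w : {linear F -> subm (ker (cover X'))},
    forall k, p k = 0 -> val (w k) = U k.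
Proof.
move=> [v vP] Up.
have wK c : ker (cover X') (U c - v (p c)) by rewrite /= linearB /= Up vP subrr.
have wL : linear (fun c => to_subm (wK c)).
  by move=> r c d; apply: val_inj => /=; rewrite !linearP /= addrACA -scalerDr.
by exists (linmap wL) => k pk /=; rewrite pk linear0 subr0.
Qed.

Lemma stably_zero_free (T : choiceType) (X : lmodType R)
  (u : {linear free R T -> X}) : stably_zero u.
Proof.
have u_onto t : exists a, cover X a = u (basis R t) by apply: cover_onto.
have [v vP] := free_projective u_onto; by exists v.
Qed.

Lemma stably_zero_comp (X Y Z : lmodType R) (f : {linear X -> Y}) (u : Y -> Z) :
  stably_zero u -> stably_zero (u \o f).
Proof. by move=> [v vP]; exists (v \o f) => x; apply: vP. Qed.

Lemma stably_zeroD (X Y : lmodType R) (u v : X -> Y) :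
  stably_zero u -> stably_zero v -> stably_zero (fun x => u x + v x).
Proof.
move=> [u' uP] [v' vP]; exists (u' \+ v') => x /=.
by rewrite linearD /= uP vP.
Qed.

(** Dimension shift: the map induced on first syzygies extends to the free cover. With
    [stably_zero_val] this carries stable vanishing up the resolution. *)
Lemma stably_zero_ker (X X' : lmodType R) (u : X -> X')
    (U : {linear free R X -> free R X'})
    (u1 : subm (ker (cover X)) -> subm (ker (cover X'))) :
    stably_zero u -> (forall c, cover X' (U c) = u (cover X c)) ->
    (forall k, val (u1 k) = U (val k)) ->
  exists w : {linear free R X -> subm (ker (cover X'))},
    forall k, u1 k = w (val k).
Proof.
move=> u0 Uu u1U; have [w wP] := stably_zero_lift u0 Uu.
by exists w => k; apply: val_inj; rewrite u1U (wP _ (submP k)).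
Qed.

Lemma stably_zero_val (X Y : lmodType R) (u : subm (ker (cover X)) -> Y)
    (w : {linear free R X -> Y}) :
  (forall k, u k = w (val k)) -> stably_zero u.
Proof.
move=> uw; have -> : u = w \o val by apply/funext.
exact/(@stably_zero_comp _ _ _ (val : subm (ker (cover X)) -> _))
  /stably_zero_free.
Qed.

(* X is, up to maps that factor through a free module, a retract of a
   finitely generated module. *)
Definition stably_fg (X : lmodType R) :=
  exists (L : lmodType R) (f : {linear X -> L}) (g : {linear L -> X}),
    fg (full_submodule L) /\ stably_zero (fun x => x - g (f x)).

(** Lift f and g to maps F, G between the free cover of X and a finite free cover p of L. They
    restrict to the kernels, and c - G (F c) lifts the stably zero map x - g (f x), which yields w.
    K is the kernel of p, a submodule of a finite free module. *)
Lemma stably_fg_syz (X : lmodType R) : noetherian R -> stably_fg X ->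
  exists (K : lmodType R) (f : {linear subm (ker (cover X)) -> K})
      (g : {linear K -> subm (ker (cover X))})
      (w : {linear free R X -> subm (ker (cover X))}),
    fg (full_submodule K) /\ forall y, y - g (f y) = w (val y).
Proof.
move=> nR [L [f [g [/fg_onto[n [p p_onto]] fgP]]]].
have [F FP] := free_projective (p := p) (h := f \o cover X) (fun t => p_onto _).
have [G GP] := free_projective (p := cover X) (h := g \o p)
  (fun t => cover_onto _).
have FK c : ker (cover X) c -> ker p (F c).
  by move=> c0; rewrite /= FP /= c0 linear0.
have GK c : ker p c -> ker (cover X) (G c).
  by move=> c0; apply: etrans (GP c) _; rewrite /= c0 linear0.
have UL : linear (fun c => c - G (F c)).
  by move=> r c d; rewrite !linearP /= addrACA -scalerDr.
have UP c : cover X (linmap UL c) = (fun x => x - g (f x)) (cover X c).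
  rewrite /= -[LHS]/(cover X (c - G (F c))) linearB /=.
  by rewrite GP /= FP.
have [w wP] := @stably_zero_lift _ _ _ (cover X) _ _ fgP UP.
exists (subm (ker p)), (subm_map FK), (subm_map GK), w; split.
  by apply: fg_subm; apply: fg_sub_free.
by move=> y; apply: val_inj; rewrite linearB (wP _ (submP y)).
Qed.

Lemma stably_fg_ker (X : lmodType R) : noetherian R -> stably_fg X ->
  stably_fg (subm (ker (cover X))).
Proof.
move=> nR /(stably_fg_syz nR)[K [f [g [w [fgK E]]]]].
by exists K, f, g; split=> //; exact: stably_zero_val E.
Qed.

Lemma stably_fg_syzn (N : lmodType R) (n : nat) : noetherian R ->
  fg (full_submodule N) -> stably_fg (syz n N).
Proof.
move=> nR fgN; elim: n => [|n IH]; last exact: (@stably_fg_ker (syz n N) nR IH).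
exists N, idfun, idfun; split=> //; exists \0 => x.
by rewrite /= subrr linear0.
Qed.
End StableMaps.

(** * Cocycles as linear maps on syzygies *)

Section Cocycles.
Variables (R : comPzRingType) (N M : lmodType R).

(** A cocycle vanishes on the image of [res_diff], that is, on the kernel of the cover, and so
    descends to the syzygy. *)
Lemma cocycle_factor n (g : cochain N M n) : cocycles N M n g ->
  exists b : {linear syz n N -> M},
    (forall c, hom_fun g c = b (cover _ c)) /\
    (forall x, b x = hom_fun g (basis R x)).
Proof.
move=> g0.
have gres d : hom_fun g (res_diff n N d) = 0.
  by rewrite -[LHS]/(val (coboundary N M n g) d) (g0 : coboundary N M n g = 0).
have gker c : cover (syz n N) c = 0 -> hom_fun g c = 0.
  move=> c0; rewrite -(gres (basis R (to_subm (N := ker (cover _)) c0))).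
  by rewrite /res_diff /= cover_surj.
have gE c c' : cover (syz n N) c = cover (syz n N) c' ->
    hom_fun g c = hom_fun g c'.
  move=> cc'; apply/subr0_eq; rewrite -linearB; apply: gker.
  by rewrite linearB /= cc' subrr.
have bL : linear (fun x => hom_fun g (basis R x)).
  move=> r x y; rewrite -linearP; apply: gE.
  by rewrite linearP /= !cover_surj.
by exists (linmap bL); split=> // c; apply: gE; rewrite cover_surj.
Qed.

Lemma cocycle_of_linear n (b : {linear syz n N -> M}) :
  exists g : subm (cocycles N M n), forall c,
    hom_fun (val g : cochain N M n) c = b (cover _ c).
Proof.
have g0 : cocycles N M n (to_hom (b \o cover (syz n N)) : cochain N M n).
  apply: val_inj; apply/funext => d /=.
  rewrite -[LHS]/(b (cover _ (val (cover (syz n.+1 N) d)))).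
  by rewrite (submP (cover (syz n.+1 N) d)) linear0.
by exists (to_subm g0).
Qed.

Lemma coboundaries_resP n (g : cochain N M n.+1) : coboundaries N M n.+1 g <->
  exists G : {linear free R (syz n N) -> M}, forall c,
    hom_fun g c = G (res_diff n N c).
Proof.
split=> [[h _ <-]|[G gG]].
  by exists (HB.pack_for {linear free R (syz n N) -> M} (hom_fun h)).
exists (to_hom G : cochain N M n) => //; apply: val_inj; apply/funext => c.
exact: esym (gG c).
Qed.

(** For a cocycle, this is the description of Ext^(n+1) as the maps on the syzygy modulo those that
    extend to the free module containing it. *)
Lemma coboundariesSP n (g : cochain N M n.+1) : coboundaries N M n.+1 g <->
  exists G : {linear free R (syz n N) -> M}, forall y : syz n.+1 N,
    hom_fun g (basis R y) = G (val (y : subm _)).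
Proof.
split=> [/coboundaries_resP[G gG]|[G gG]].
  exists G => y.
  by rewrite gG /res_diff /= cover_surj.
apply/coboundaries_resP; exists G.
apply: (@free_ext _ _ _ (hom_fun g) (G \o res_diff n N)) => y.
by apply: etrans (gG y) _; rewrite /res_diff /= cover_surj.
Qed.
End Cocycles.

Lemma hom_funP (R : comPzRingType) (L M : lmodType R) (r : R)
    (f g : Hom L M) c :
  hom_fun (r *: f + g) c = r *: hom_fun f c + hom_fun g c.
Proof. by []. Qed.

Lemma hom_funZ (R : comPzRingType) (L M : lmodType R) (r : R) (f : Hom L M) c :
  hom_fun (r *: f) c = r *: hom_fun f c.
Proof. by []. Qed.

Section CocycleEval.
Variables (R : comPzRingType) (N M : lmodType R) (n : nat).

Definition cocycle_fun (z : subm (cocycles N M n)) : free R (syz n N) -> M :=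
  hom_fun (val z : cochain N M n).

Lemma cocycle_funP r z t c :
  cocycle_fun (r *: z + t) c = r *: cocycle_fun z c + cocycle_fun t c.
Proof. by rewrite /cocycle_fun linearP; apply: hom_funP. Qed.
End CocycleEval.

(** * Ext of a finitely generated module into a weakly Laskerian one *)

Section ExtFinite.
Variables (R : comPzRingType) (N M : lmodType R).

(** Cocycles are evaluated at finitely many points, chosen so that a cocycle vanishing at all of
    them is a coboundary; then [wl_mod_evals] applies. The points are generators of N in degree 0,
    and the images under g of generators of K in positive degree. *)
Lemma Ext_weakly_laskerian j : noetherian R -> fg (full_submodule N) ->
  weakly_laskerian M -> weakly_laskerian (Ext N M j).
Proof.
move=> nR fgN wM; apply: wl_mod_mquot.
have evL (c : free R (syz j N)) :
    linear (fun z : subm (cocycles N M j) => cocycle_fun z c).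
  by move=> r z t; apply: cocycle_funP.
have vanish (K : lmodType R) (h : {linear K -> M}) n (g : nat -> K) :
    (forall y, full_submodule K y ->
       exists c : nat -> R, y = \sum_(i < n) c i *: g i) ->
    (forall i, (i < n)%N -> h (g i) = 0) -> forall y, h y = 0.
  move=> gspan hg y; have [c ->] := gspan y I.
  by rewrite linear_sum big1 // => i _; rewrite linearZ /= hg ?scaler0.
case: j evL => [|j] evL.
  have [n [g [_ gspan]]] := fgN.
  apply: (wl_mod_evals (n := n)
    (fs := fun i => linmap (evL (basis R (g i : syz 0 N))))) => // z _ zg.
  have [b [zb bz]] := cocycle_factor (submP z).
  apply: val_inj; apply/funext => c.
  rewrite -[LHS]/(hom_fun (val z : cochain N M 0) c) zb.
  by apply: (vanish N b _ _ gspan) => i ilt; rewrite bz; apply: zg.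
have [K [f [g [w [[n [k [_ kspan]]] E]]]]] :=
  stably_fg_syz nR (stably_fg_syzn j nR fgN).
apply: (wl_mod_evals (n := n)
  (fs := fun i => linmap (evL (basis R (g (k i) : syz j.+1 N))))) => // z _ zg.
have [b [zb bz]] := cocycle_factor (submP z).
(* Since y = g (f y) + w (val y) and b \o g vanishes on the generators of K, b agrees with b \o w,
   which is defined on the whole free module. *)
apply/coboundariesSP; exists (b \o w) => y /=.
rewrite -E linearB -bz.
have -> : b (g (f y)) = 0.
  by apply: (vanish K (b \o g) _ _ kspan) => i ilt /=; rewrite bz; apply: zg.
by rewrite subr0.
Qed.
End ExtFinite.

(** * Scalars that annihilate the first argument of Ext *)

Section ScalarKill.
Variable R : comPzRingType.

Lemma scale_linear (A : lmodType R) (y : R) : linear (fun c : A => y *: c).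
Proof. by move=> r c d; rewrite scalerDr !scalerA mulrC. Qed.

Definition scale_map (A : lmodType R) (y : R) := linmap (@scale_linear A y).

Lemma stably_zero_scale_ker (X : lmodType R) (y : R) :
    stably_zero (scale_map X y) ->
  exists w : {linear free R X -> subm (ker (cover X))},
    forall k, scale_map _ y k = w (val k).
Proof.
move=> y0.
have H1 c : cover X (scale_map _ y c) = scale_map X y (cover X c).
  exact: linearZ.
have H2 (k : subm (ker (cover X))) :
  val (scale_map _ y k) = scale_map _ y (val k) by exact: linearZ.
exact: (@stably_zero_ker R X X _ _ _ y0 H1 H2).
Qed.

Lemma stably_zero_scale (N : lmodType R) (y : R) n :
    (forall l : N, y *: l = 0) ->
  stably_zero (scale_map (syz n N) y).
Proof.
move=> yN; elim: n => [|n IH]; first by exists \0 => x; rewrite linear0 [RHS]yN.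
have [w wP] := @stably_zero_scale_ker (syz n N) y IH.
exact: (@stably_zero_val _ _ _ _ w wP).
Qed.

(** So y annihilates Ext^n(N, M): multiplication by y is stably zero on the syzygies, hence in
    positive degree y *: z extends to the free module. *)
Lemma scale_coboundary (N M : lmodType R) (y : R) n (z : cochain N M n) :
    (forall l : N, y *: l = 0) -> cocycles N M n z ->
  coboundaries N M n (y *: z).
Proof.
move=> yN /cocycle_factor[b [zb bz]]; case: n z b zb bz => [|n] z b zb bz.
  apply: val_inj; apply/funext => c.
  by rewrite [LHS]hom_funZ zb -linearZ /= yN linear0.
have [w wP] := @stably_zero_scale_ker (syz n N) y (stably_zero_scale n yN).
apply/coboundariesSP; exists (b \o w) => k /=.
by rewrite -wP hom_funZ -bz -linearZ.
Qed.

(** Every class has a representative killed by y. In positive degree y *: z is the coboundary of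
    some G; divisibility of M gives H with y H = G, and z' is z minus the coboundary of H. In degree
    0 already y *: z = 0. *)
Lemma cocycle_divisible (N M : lmodType R) (y : R) n
    (z : subm (cocycles N M n)) :
    (forall l : N, y *: l = 0) -> (forall m : M, exists m', y *: m' = m) ->
  exists z' : subm (cocycles N M n), exact_cocycles N M n (z - z') /\
    forall c, y *: cocycle_fun z' c = 0.
Proof.
move=> yN ydiv; have := scale_coboundary yN (submP z).
case: n z => [|n] z.
  move=> yz; exists z; split; first by rewrite subrr; apply: submodule0.
  by move=> c; rewrite -[LHS]/(hom_fun (y *: val z : cochain N M 0) c) yz.
move=> /coboundaries_resP[G GP].
have [H HP] := free_projective (p := scale_map M y) (h := G) (fun t => ydiv _).
pose d := coboundary N M n (to_hom H).
have dE c : hom_fun d c = H (res_diff n N c) by [].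
have dP : coboundaries N M n.+1 d by exists (to_hom H).
have dZ : cocycles N M n.+1 d.
  apply: val_inj; apply/funext => c.
  rewrite -[LHS]/(hom_fun d (res_diff n.+1 N c)) dE.
  by rewrite (proj2 (res_diff_exact _)) ?linear0 //; exists c.
exists (-1 *: to_subm dZ + z); split.
  by rewrite scaleN1r opprD opprK addrCA subrr addr0.
move=> c; rewrite cocycle_funP.
rewrite -[cocycle_fun (to_subm _) c]/(hom_fun d c) dE scaleN1r scalerDr scalerN.
by rewrite -[y *: H _]/(scale_map M y (H _)) HP -GP hom_funZ addNr.
Qed.

(** The inclusion of the kernel K of y induces a surjection Ext^n(N, K) -> Ext^n(N, M), because a
    cocycle killed by y takes its values in K. *)
Lemma Ext_divisible_weakly_laskerian (N M : lmodType R) (y : R) n :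
    (forall l : N, y *: l = 0) -> (forall m : M, exists m', y *: m' = m) ->
    weakly_laskerian (Ext N (subm (ker (scale_map M y))) n) ->
  weakly_laskerian (Ext N M n).
Proof.
move=> yN ydiv; set K := subm _.
pose rep (z : subm (cocycles N K n)) (z' : subm (cocycles N M n)) :=
  forall c, cocycle_fun z' c = val (cocycle_fun z c).
apply: (@weakly_laskerian_subquotient _ _ _ (fun e e' => exists z z',
  [/\ e = mquot_pi _ z, e' = mquot_pi _ z' & rep z z'])).
- move=> r _ _ _ _ [z [z' [-> -> zz']]] [t [t' [-> -> tt']]].
  exists (r *: z + t), (r *: z' + t'); split; rewrite ?linearP // => c.
  by rewrite !cocycle_funP zz' tt' linearP.
- move=> e'; have [z' [e'z' yz']] := cocycle_divisible (repr e') yN ydiv.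
  pose f c : K := to_subm (N := ker (scale_map M y)) (yz' c).
  have fL : linear f.
    by move=> r c d; apply: val_inj; rewrite /= /cocycle_fun linearP.
  have fZ : cocycles N K n (to_hom (linmap fL) : cochain N K n).
    apply: val_inj; apply/funext => c; apply: val_inj => /=.
    by have := congr1 (fun h => val h c) (submP z').
  exists (mquot_pi _ (to_subm fZ)), (to_subm fZ), z'; split=> //.
  by rewrite -[e' in LHS]mquot_pi_surj; apply/mquot_piP.
move=> _ [z [z' [/esym + -> zz']]].
rewrite -(linear0 (mquot_pi _)) => /mquot_piP; rewrite subr0 => z0.
rewrite -(linear0 (mquot_pi _)); apply/mquot_piP; rewrite subr0.
case: n z z' @rep zz' z0 => [|n] z z' rep zz' z0.
  apply: val_inj; apply/funext => c.
  by apply: etrans (zz' c) _; rewrite /cocycle_fun (z0 : val z = 0).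
have /coboundariesSP[G GP] := z0.
apply/coboundariesSP; exists (val \o G) => k.
by apply: etrans (zz' _) _; rewrite /cocycle_fun GP.
Qed.
End ScalarKill.

(** * Elements of a sequential direct limit and their vanishing *)

Section DirectLimits.
Variables (R : comPzRingType) (X : nat -> lmodType R).
Variable phi : forall n, {linear X n -> X n.+1}.

(** With the index [k + n], the successor case typechecks by computation, without a cast. *)
Fixpoint trans k n (x : X n) : X (k + n)%N :=
  if k is k'.+1 then phi _ (trans k' x) else x.

Lemma dirlim_in_trans k n (x : X n) :
  dirlim_in phi (trans k x) = dirlim_in phi x.
Proof. by elim: k => //= k <-; rewrite dirlim_in_compat. Qed.

Lemma ds_in_same n (x : X n) : val (ds_in x) n = x.
Proof. exact: dfwith_in. Qed.

Lemma ds_in_other n (x : X n) m : n != m -> val (ds_in x) m = 0.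
Proof. exact: dfwith_out. Qed.

Lemma ds_in_linear n : linear (@ds_in R X n).
Proof.
move=> r x y; apply: val_inj; apply: prod_ext => m.
rewrite linearP -[RHS]/(r *: val (ds_in x) m + val (ds_in y) m).
have [<-|nm] := eqVneq n m; first by rewrite !ds_in_same.
by rewrite !ds_in_other // scaler0 addr0.
Qed.

Lemma dirlim_in_linear n : linear (@dirlim_in R X phi n).
Proof. by move=> r x y; rewrite /dirlim_in ds_in_linear linearP. Qed.

Definition dirlim_map n := linmap (@dirlim_in_linear n).

Lemma dirlim_onto (h : dirlim phi) : exists n (x : X n), h = dirlim_in phi x.
Proof.
rewrite -[h]mquot_pi_surj; move: (repr h) => {h} z.
have [m zm] := submP z; exists m.
elim: m z zm => [|m IH] z zm.
  exists 0; rewrite -[RHS]/(dirlim_map 0 0) linear0.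
  suff -> : z = 0 by rewrite linear0.
  by apply: val_inj; apply: prod_ext => n; apply: zm.
have [n mn|x xP] := IH (-1 *: ds_in (val z m) + z).
  rewrite linearP -[LHS]/(-1 *: val (ds_in (val z m)) n + val z n).
  have [<-|nm] := eqVneq m n; first by rewrite ds_in_same scaleN1r addNr.
  by rewrite ds_in_other // scaler0 add0r zm // ltn_neqAle nm.
(* x represents z without its component m; that component is added back in [X m], and the sum is
   pushed to [X m.+1]. *)
exists (phi m (x + val z m)); rewrite dirlim_in_compat.
rewrite -[RHS]/(dirlim_map m _) linearD /= -xP -linearD.
by rewrite scaleN1r addrAC addNr add0r.
Qed.

(* The images in X k of the components of z of index less than k, added up. *)
Fixpoint partial_sum (z : prod_fam X) k : X k :=
  if k is k'.+1 then phi k' (partial_sum z k' + z k') else 0.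

Lemma partial_sumP r z t k :
  partial_sum (r *: z + t) k = r *: partial_sum z k + partial_sum t k.
Proof.
elim: k => [|k IH] /=; first by rewrite scaler0 addr0.
rewrite IH -[(r *: z + t) k]/(r *: z k + t k) -linearP scalerDr.
by congr (phi _ _); rewrite addrACA.
Qed.

Lemma partial_sum0 (z : prod_fam X) m k : partial_sum z m = 0 ->
  (forall j, (m <= j)%N -> z j = 0) -> (m <= k)%N -> partial_sum z k = 0.
Proof.
move=> zm zj; elim: k => [|k IH]; first by rewrite leqn0 => /eqP <-.
rewrite leq_eqVlt => /predU1P[<- //|]; rewrite ltnS => mk /=.
by rewrite IH // zj // addr0 linear0.
Qed.

Lemma partial_sum_below (z : prod_fam X) m :
  (forall j, (j < m)%N -> z j = 0) -> partial_sum z m = 0.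
Proof.
elim: m => //= m IH zj; rewrite IH ?zj ?addr0 ?linear0 // => j jm.
by apply: zj; apply: ltnW.
Qed.

Lemma partial_sum_cancel (z : prod_fam X) m (y : X m) k :
    z m = y -> z m.+1 = - phi m y ->
    (forall j, j != m -> j != m.+1 -> z j = 0) -> (m.+2 <= k)%N ->
  partial_sum z k = 0.
Proof.
move=> zm zm1 zj; apply: partial_sum0 => [|j mj].
  rewrite /= zm zm1 partial_sum_below ?add0r ?subrr ?linear0 // => j jm.
  by apply: zj; rewrite ltn_eqF // ltnS ltnW.
by apply: zj; rewrite gtn_eqF // ltnW.
Qed.

Lemma partial_sum_in n (x : X n) k :
  partial_sum (val (ds_in x)) (k.+1 + n)%N = trans k.+1 x.
Proof.
elim: k => [|k IH].
  rewrite -[LHS]/(phi n (partial_sum (val (ds_in x)) n + val (ds_in x) n)).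
  rewrite partial_sum_below ?add0r ?ds_in_same // => j jn.
  by rewrite ds_in_other // gtn_eqF.
rewrite -[LHS]/(phi _ (partial_sum (val (ds_in x)) (k.+1 + n)%N
  + val (ds_in x) (k.+1 + n)%N)).
by rewrite IH ds_in_other ?addr0 // ltn_eqF // addSn ltnS leq_addl.
Qed.

(** The families whose partial sums vanish eventually form a submodule containing all the relations,
    hence [ds_in x]; its late partial sums are the [trans k x]. *)
Lemma dirlim_in_eq0 n (x : X n) :
  dirlim_in phi x = 0 -> exists k, trans k x = 0.
Proof.
rewrite /dirlim_in -(linear0 (mquot_pi _)) => /mquot_piP; rewrite subr0.
have SP : is_submodule [set z : direct_sum X |
    exists m, forall k, (m <= k)%N -> partial_sum (val z) k = 0].
  split=> [|r z t [m zm] [l tl]].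
    by exists 0%N => k _; apply: partial_sum_below.
  exists (maxn m l) => k; rewrite geq_max => /andP[mk lk].
  by rewrite linearP partial_sumP zm // tl // scaler0 addr0.
move=> /(_ (Submodule SP))[].
  move=> _ [m [y ->]] /=; exists m.+2.
  move=> k; apply: (@partial_sum_cancel _ m y) => [||j mj jm].
  - rewrite -[LHS]/(val (ds_in y) m - val (ds_in (phi m y)) m).
    by rewrite ds_in_same ds_in_other ?subr0 // gtn_eqF.
  - rewrite -[LHS]/(val (ds_in y) m.+1 - val (ds_in (phi m y)) m.+1).
    by rewrite ds_in_same ds_in_other ?sub0r // ltn_eqF.
  rewrite -[LHS]/(val (ds_in y) j - val (ds_in (phi m y)) j).
  by rewrite !ds_in_other ?subr0 // eq_sym.
move=> m xm; exists m.+1; rewrite -partial_sum_in; apply: xm.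
by rewrite addSnnS leq_addr.
Qed.

End DirectLimits.

(** * Supports of torsion modules, and cyclic modules *)

Lemma Supp_sub_V (R : comPzRingType) (I : ideal R) (M : lmodType R) :
    (forall (y : R) (m : M), I y -> exists n, y ^+ n *: m = 0) ->
  Supp M `<=` V I.
Proof.
move=> IM P [z]; rewrite -[z]frac_repr => z0 y /= Iy; apply: contrapT => Py.
apply: z0; have [n yn] := IM y (repr z).1 Iy.
(* As y lies outside P, so does y^n, which kills the numerator and makes the fraction zero. *)
have Pyn : `[< ~ P (y ^+ n) >].
  apply/asboolP; elim: n {yn} => [|n IH].
    by rewrite expr0; apply: spec_proper.
  by rewrite exprS => /spec_prime[].
by apply/fracP; exists (exist _ (y ^+ n) Pyn); rewrite /= mulr1 yn scaler0.
Qed.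

Lemma mquot_cyclic (R : comPzRingType) (I : ideal R) (l : mquot I) :
  exists r : R, l = r *: mquot_pi I (1 : R^o).
Proof.
exists (repr l); rewrite -linearZ -[LHS]mquot_pi_surj.
by congr (mquot_pi _ _); rewrite [RHS]mulr1.
Qed.

Lemma mquot_fg (R : comPzRingType) (I : ideal R) :
  fg (full_submodule (mquot I)).
Proof.
exists 1%N, (fun=> mquot_pi I (1 : R^o)); split=> // l _.
by have [r ->] := mquot_cyclic l; exists (fun=> r); rewrite big_ord1.
Qed.

Lemma subnDK k n l : (k + n <= l)%N -> (l - (k + n) + k = l - n)%N.
Proof.
move=> knl; have nl : (n <= l)%N by rewrite (leq_trans _ knl) ?leq_addl.
by rewrite [(k + n)%N]addnC subnDA subnK // -(leq_add2r n) subnK.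
Qed.

(** * Powers of a principal ideal and syzygies of R/x^n *)

Section PrincipalPowers.
Variables (R : comPzRingType) (a : ideal R) (x : R).
Hypothesis aP : forall y : R, a y <-> exists r, y = r * x.

Lemma ideal_pow_principal n (y : R) :
  ideal_pow a n y <-> exists r, y = r * x ^+ n.
Proof.
elim: n y => [|n IH] y; first by split=> // _; exists y; rewrite expr0 mulr1.
split=> [|[r ->]].
  have SP : is_submodule [set y : R^o | exists r, y = r * x ^+ n.+1].
    split=> [|s _ _ [r ->] [t ->]]; first by exists 0; rewrite mul0r.
    by exists (s * r + t); rewrite mulrDl -mulrA.
  move=> /(_ (Submodule SP)); apply=> _ [u [v [/aP[r ->] /IH[s ->] ->]]].
  by exists (r * s); rewrite exprS mulrACA.
move=> N; apply; exists (r * x), (x ^+ n); split.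
- by apply/aP; exists r.
- by apply/IH; exists 1; rewrite mul1r.
by rewrite exprS mulrA.
Qed.

(** The union of the annihilators of the x^n is an ideal; c bounds the exponents that its finitely
    many generators require. *)
Lemma annihilators_stable : noetherian R ->
  exists c, forall n r, r * x ^+ n = 0 -> r * x ^+ c = 0.
Proof.
move=> nR.
have raise r n m : (n <= m)%N -> r * x ^+ n = 0 -> r * x ^+ m = 0.
  by move=> nm rn; rewrite -(subnKC nm) exprD mulrA rn mul0r.
have SP : is_submodule [set r : R^o | exists n, (r : R) * x ^+ n = 0].
  split=> [|s r t [n rn] [m tm]]; first by exists 0%N; rewrite mul0r.
  exists (maxn n m); rewrite mulrDl -mulrA (raise r n) ?leq_maxl //.
  by rewrite (raise t m) ?leq_maxr // mulr0 addr0.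
have [k [g [gS gspan]]] := noetherian_fg nR (Submodule SP).
have [c cP] : exists c, forall i, (i < k)%N -> (g i : R) * x ^+ c = 0.
  elim: k gS {gspan} => [|k IH] gS; first by exists 0%N.
  have [i ik|c cP] := IH; first by apply: gS; apply: ltnW.
  have [n gn] := gS k (ltnSn k).
  exists (maxn c n) => i; rewrite ltnS leq_eqVlt => /predU1P[->|ik].
    by rewrite (raise _ n) ?leq_maxr.
  by rewrite (raise _ c) ?leq_maxl // cP.
exists c => n r rn; have [d ->] := gspan r (ex_intro _ n rn).
rewrite mulr_suml big1 // => i _.
by rewrite -[d i *: g i]/(d i * g i) -mulrA cP ?mulr0.
Qed.

Variable c : nat.
Hypothesis cP : forall n r, r * x ^+ n = 0 -> r * x ^+ c = 0.

Let L n : lmodType R := mquot (ideal_pow a n).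
Let S n : lmodType R := subm (ker (cover (L n))).
Let one n : free R (L n) := basis R (mquot_pi (ideal_pow a n) (1 : R^o)).

Fact pow_syz_ker n : ker (cover (L n)) (x ^+ n *: one n).
Proof.
rewrite /= linearZ /= cover_surj -linearZ -(linear0 (mquot_pi _)).
apply/mquot_piP/ideal_pow_principal; exists 1.
by rewrite subr0 mul1r [LHS]mulr1.
Qed.
Definition pow_syz n : S n := to_subm (pow_syz_ker n).

Lemma cover_section n : exists Psi : {linear free R (L n) -> R^o},
  Psi (one n) = 1 /\ forall d, mquot_pi (ideal_pow a n) (Psi d) = cover (L n) d.
Proof.
pose pi : {linear R^o -> L n} := mquot_pi (ideal_pow a n).
have [s [s1 sP]] : exists s : L n -> R^o,
    s (pi 1) = 1 /\ forall l, pi (s l) = l.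
  (* [repr] may pick another representative of the class of 1, so the value there is imposed. *)
  exists (fun l => if l == pi 1 then 1 else repr l); rewrite eqxx; split=> // l.
  by case: eqP => [->//|_]; exact: mquot_pi_surj.
exists (free_lift s); split; first exact: etrans (free_lift_basis _ _) s1.
move=> d; apply: etrans (free_lift_comp pi s d) _.
by congr (free_lift _ d); apply/funext => l; apply: sP.
Qed.

(** For y in the syzygy, Psi y lies in (x^n), say Psi y = r x^n, and w d = d - Psi d *: one gives
    the decomposition. The factor r is unique only up to the annihilator of x^n, which x^c kills, so
    r x^c is well defined and linear in y. *)
Lemma pow_syz_decomp n :
  exists (Psi : {linear free R (L n) -> R^o}) (w : {linear free R (L n) -> S n})
      (rho : {linear S n -> R^o}),
    rho (pow_syz n) = x ^+ c /\
    forall y : S n, exists r : R, [/\ y = r *: pow_syz n + w (val y),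
      rho y = r * x ^+ c & Psi (val y) = r * x ^+ n].
Proof.
have [Psi [Psi1 PsiP]] := cover_section n.
have [w wE] : exists w : {linear free R (L n) -> S n},
    forall d, val (w d) = d - (Psi d : R) *: one n.
  have wK d : ker (cover (L n)) (d - (Psi d : R) *: one n).
    apply: etrans (linearB (cover (L n)) _ _) _; apply/subr0_eq.
    rewrite subr0 linearZ /= cover_surj -linearZ -(PsiP d).
    by rewrite [_ *: _]mulr1 subrr.
  have wL : linear (fun d => to_subm (wK d) : S n).
    move=> r d e; apply: val_inj.
    transitivity (r *: (d - (Psi d : R) *: one n) + (e - (Psi e : R) *: one n)).
      have PsiD : Psi (r *: d + e) = r * (Psi d : R) + (Psi e : R) :> R.
        exact: linearP.
      rewrite -[LHS]/(r *: d + e - (Psi (r *: d + e) : R) *: one n) PsiD.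
      by rewrite scalerDl scalerBr scalerA opprD addrACA.
    by apply: esym; exact: linearP.
  by exists (linmap wL).
have /choice[q qP] : forall y : S n, exists r : R, Psi (val y) = r * x ^+ n.
  move=> y; apply/ideal_pow_principal.
  rewrite -[Psi (val y)]subr0; apply/mquot_piP.
  by rewrite linear0; apply: etrans (PsiP _) _; exact: (submP y).
have qE y r : Psi (val y) = r * x ^+ n -> q y * x ^+ c = r * x ^+ c.
  rewrite qP => E; apply/subr0_eq; rewrite -mulrBl.
  by apply: (cP (n := n)); rewrite mulrBl E subrr.
have [rho rhoE] : exists rho : {linear S n -> R^o},
    forall y, rho y = q y * x ^+ c.
  have rL : linear (fun y : S n => q y * x ^+ c : R^o).
    move=> r y z; rewrite (qE _ (r * q y + q z)) ?mulrDl -?mulrA //.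
    by rewrite linearP !qP.
  by exists (linmap rL).
have pE : val (pow_syz n) = x ^+ n *: one n by [].
exists Psi, w, rho; split.
  by rewrite rhoE (qE _ 1) ?mul1r // pE linearZ Psi1 [LHS]mulr1.
move=> y; exists (q y); split; [|exact: rhoE|exact: qP].
apply: val_inj; transitivity (q y *: val (pow_syz n) + val (w (val y))).
  by rewrite pE wE scalerA -qP addrC subrK.
by apply: esym; exact: linearP.
Qed.

Fixpoint pow_trans i k n : {linear syz i (L (k + n)) -> syz i (L n)} :=
  if k is k'.+1 then pow_trans i k' n \o syz_map i (pow_proj a (k' + n))
  else idfun.

Fixpoint free_pow_trans i k n :
    {linear free R (syz i (L (k + n))) -> free R (syz i (L n))} :=
  if k is k'.+1
  then free_pow_trans i k' n \o cover_map (syz_map i (pow_proj a (k' + n)))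
  else idfun.

Lemma cover_pow_trans i k n d :
  cover _ (free_pow_trans i k n d) = pow_trans i k n (cover _ d).
Proof. by elim: k d => //= k IH d; rewrite IH cover_natural. Qed.

Lemma val_pow_trans i k n (y : syz i.+1 (L (k + n))) :
  val (pow_trans i.+1 k n y : subm _) = free_pow_trans i k n (val (y : subm _)).
Proof. by elim: k y => //= k IH y; rewrite IH. Qed.

Lemma free_pow_trans_one k n : free_pow_trans 0 k n (one (k + n)) = one n.
Proof.
elim: k => // k IH; rewrite -[RHS]IH.
rewrite -[LHS]/(free_pow_trans 0 k n (cover_map _ (one (k.+1 + n)))).
congr (free_pow_trans 0 k n _); apply: etrans (free_lift_basis _ _) _.
by congr (basis R _); exact: mquot_mapE.
Qed.

Lemma pow_trans_pow_syz k n :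
  pow_trans 1 k n (pow_syz (k + n)) = x ^+ k *: pow_syz n.
Proof.
apply: val_inj; apply: etrans (@val_pow_trans 0 k n (pow_syz (k + n))) _.
have -> : val (pow_syz (k + n)) = x ^+ (k + n) *: one (k + n) by [].
have -> : val (x ^+ k *: pow_syz n) = x ^+ k *: (x ^+ n *: one n).
  exact: linearZ.
rewrite linearZ scalerA -exprD.
by congr (_ *: _); exact: free_pow_trans_one.
Qed.

Lemma pow_trans_factor k n i : stably_zero (pow_trans i k n) ->
  exists w : {linear free R (syz i (L (k + n))) -> syz i.+1 (L n)},
    forall y : syz i.+1 (L (k + n)),
      pow_trans i.+1 k n y = w (val (y : subm _)).
Proof.
move=> T0; exact: (@stably_zero_ker R _ _ _ _ (pow_trans i.+1 k n) T0
  (@cover_pow_trans i k n) (@val_pow_trans i k n)).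
Qed.

(** On first syzygies the map is y |-> rho y *: pow_syz n + T (w (val y)): the first summand factors
    through R, the second extends to the free cover. Higher syzygies follow by dimension shift. *)
Lemma pow_trans_stably_zero n i : stably_zero (pow_trans i.+1 c n).
Proof.
elim: i => [|i IH]; last first.
  have [w wP] := pow_trans_factor IH.
  exact: (@stably_zero_val _ _ _ _ w wP).
have [Psi [w [rho [_ yP]]]] := pow_syz_decomp (c + n).
pose T : {linear S (c + n) -> S n} := pow_trans 1 c n.
have f1L : linear (fun r : R^o => (r : R) *: basis R (pow_syz n)).
  by move=> r s t; rewrite scalerDl scalerA.
have f1P : stably_zero (fun y : S (c + n) => (rho y : R) *: pow_syz n).
  exists (linmap f1L \o rho) => y.
  by rewrite linearZ /= cover_surj.
have f2P : stably_zero (fun y : S (c + n) => T (w (val y))).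
  exact: (stably_zero_val (w := T \o w)).
have := stably_zeroD f1P f2P; congr stably_zero; apply/funext => y.
have [r [yE rhoE _]] := yP y.
by rewrite [in RHS]yE linearP rhoE pow_trans_pow_syz scalerA.
Qed.

(** * Local cohomology classes: torsion, support, vanishing above degree 1 *)

Variable M : lmodType R.

Let C i n := subm (cocycles (L n) M i).

Definition lc_class i n (z : C i n) : local_cohomology a i M :=
  dirlim_in (fun n => Ext_map M (pow_proj a n) i)
    (mquot_pi (exact_cocycles (L n) M i) z).

Lemma lc_class_onto i (h : local_cohomology a i M) :
  exists n (z : C i n), h = lc_class z.
Proof.
have [n [e ->]] := dirlim_onto h; exists n, (repr e).
by rewrite /lc_class mquot_pi_surj.
Qed.

Lemma lc_classP i n r (z t : C i n) :
  lc_class (r *: z + t) = r *: lc_class z + lc_class t.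
Proof. by rewrite /lc_class linearP dirlim_in_linear. Qed.

Lemma lc_class0 i n (z : C i n) : exact_cocycles (L n) M i z -> lc_class z = 0.
Proof.
move=> z0; rewrite /lc_class.
have -> : mquot_pi (exact_cocycles (L n) M i) z = 0.
  by rewrite -(linear0 (mquot_pi _)); apply/mquot_piP; rewrite subr0.
exact: (linear0 (dirlim_map (fun n => Ext_map M (pow_proj a n) i) n)).
Qed.

Lemma trans_cocycle i k n (z : C i n) : exists z' : C i (k + n),
  trans (fun n => Ext_map M (pow_proj a n) i) k
    (mquot_pi (exact_cocycles (L n) M i) z) = mquot_pi _ z' /\
  forall y, cocycle_fun z' (basis R y)
          = cocycle_fun z (basis R (pow_trans i k n y)).
Proof.
elim: k => [|k [z' [E zy]]]; first by exists z.
exists (subm_map (@cochain_map_cocycles _ _ _ M (pow_proj a (k + n)) i) z').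
split=> [|y].
  apply: etrans (congr1 (Ext_map M (pow_proj a (k + n)) i) E) _.
  exact: mquot_mapE.
apply: etrans (zy _).
rewrite -[LHS]/(cocycle_fun z' (cover_map (syz_map i (pow_proj a (k + n)))
  (basis R y))).
by congr (cocycle_fun z' _); exact: free_lift_basis.
Qed.

Lemma lc_class_trans i k n (z : C i n) : exists z' : C i (k + n),
  lc_class z' = lc_class z /\
  forall y, cocycle_fun z' (basis R y)
          = cocycle_fun z (basis R (pow_trans i k n y)).
Proof.
have [z' [E zy]] := trans_cocycle k z; exists z'; split=> //.
by rewrite /lc_class -E dirlim_in_trans.
Qed.

Lemma lc_class_eq0 i n (z : C i n) : lc_class z = 0 ->
  exists k (z' : C i (k + n)), exact_cocycles (L (k + n)) M i z' /\
    forall y, cocycle_fun z' (basis R y)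
            = cocycle_fun z (basis R (pow_trans i k n y)).
Proof.
move=> /dirlim_in_eq0[k k0]; have [z' [E zy]] := trans_cocycle k z.
exists k, z'; split=> //.
move: k0; rewrite E -(linear0 (mquot_pi _)) => /mquot_piP.
by rewrite subr0.
Qed.

Lemma pow_kills n (l : L n) : x ^+ n *: l = 0.
Proof.
rewrite -[l]mquot_pi_surj -linearZ -(linear0 (mquot_pi _)).
apply/mquot_piP/ideal_pow_principal; exists (repr l).
by rewrite subr0 mulrC.
Qed.

Lemma lc_torsion i (h : local_cohomology a i M) : exists n, x ^+ n *: h = 0.
Proof.
have [n [z ->]] := lc_class_onto h; exists n.
have H : exact_cocycles (L n) M i (x ^+ n *: z).
  exact: (@scale_coboundary _ (L n) M _ _ (val z) (@pow_kills n) (submP z)).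
have E := lc_classP (x ^+ n) z 0.
have Z0 : lc_class (0 : C i n) = 0 by apply: lc_class0; apply: submodule0.
by rewrite Z0 !addr0 in E; rewrite -E; apply: lc_class0.
Qed.

Lemma lc_support i : Supp (local_cohomology a i M) `<=` V a.
Proof.
apply: Supp_sub_V => y h /aP[r ->]; have [n xh] := lc_torsion h.
by exists n; rewrite exprMn -scalerA xh scaler0.
Qed.

(** After c transition steps any cocycle extends to the free module, hence becomes a coboundary. *)
Lemma lc_vanish i (h : local_cohomology a i.+2 M) : h = 0.
Proof.
have [n [z ->]] := lc_class_onto h.
have [z' [<- zy]] := lc_class_trans c z.
have [w wP] := pow_trans_factor (pow_trans_stably_zero n i).
have [b [zb bz]] := cocycle_factor (submP z).
apply: lc_class0; apply/coboundariesSP; exists (b \o w) => y.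
by apply: etrans (zy y) _; rewrite -[LHS]bz wP.
Qed.

(** * Degree 0: a class is determined by its value at 1 *)

Definition eval0 n (z : C 0 n) : M := cocycle_fun z (one n).

Lemma eval0P n r (z t : C 0 n) : eval0 (r *: z + t) = r *: eval0 z + eval0 t.
Proof. exact: cocycle_funP. Qed.

Lemma raise_eval0 n N (z : C 0 n) : (n <= N)%N ->
  exists z' : C 0 N, lc_class z' = lc_class z /\ eval0 z' = eval0 z.
Proof.
move=> nN; rewrite -(subnK nN).
have [z' [E zy]] := lc_class_trans (N - n) z.
exists z'; split=> //; apply: etrans (zy _) _.
congr (cocycle_fun z (basis R _)).
have := @cover_pow_trans 0 (N - n) n (one _).
by rewrite free_pow_trans_one !cover_surj.
Qed.

Lemma lc0_weakly_laskerian :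
  weakly_laskerian M -> weakly_laskerian (local_cohomology a 0 M).
Proof.
apply: (@weakly_laskerian_subquotient _ _ _ (fun m h =>
  exists n (z : C 0 n), h = lc_class z /\ eval0 z = m)).
- move=> r _ _ _ _ [n [z [-> <-]]] [n' [z' [-> <-]]].
  have [t [<- <-]] := raise_eval0 z (leq_maxl n n').
  have [t' [<- <-]] := raise_eval0 z' (leq_maxr n n').
  exists (maxn n n'), (r *: t + t'); split; first by rewrite lc_classP.
  exact: eval0P.
- by move=> h; have [n [z ->]] := lc_class_onto h; exists (eval0 z), n, z.
move=> _ [n [z [-> z0]]]; have [b [zb bz]] := cocycle_factor (submP z).
apply: lc_class0; apply: val_inj; apply/funext => d.
apply: etrans (zb d) _; move: (cover _ d) => l.
have [r lE] := mquot_cyclic (l : L n).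
apply: etrans (congr1 b lE) _; rewrite linearZ bz.
by apply: etrans (congr1 ( *:%R r) z0) _; rewrite scaler0.
Qed.

(** * Degree 1: the class of z at level n as the fraction [eval1 z] / x^n *)

Definition eval1 n (z : C 1 n) : M :=
  cocycle_fun z (basis R (pow_syz n : syz 1 (L n))).

Lemma eval1P n r (z t : C 1 n) : eval1 (r *: z + t) = r *: eval1 z + eval1 t.
Proof. exact: cocycle_funP. Qed.

Lemma eval1_trans k n (z : C 1 n) (z' : C 1 (k + n)) :
    (forall y, cocycle_fun z' (basis R y)
             = cocycle_fun z (basis R (pow_trans 1 k n y))) ->
  eval1 z' = x ^+ k *: eval1 z.
Proof.
move=> zy; have [b [_ bz]] := cocycle_factor (submP z).
apply: etrans (zy _) _; rewrite pow_trans_pow_syz.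
by rewrite /eval1 -[LHS]bz linearZ bz.
Qed.

Lemma eval1_exact n (z : C 1 n) :
  exact_cocycles (L n) M 1 z <-> exists m, eval1 z = x ^+ n *: m.
Proof.
split=> [/coboundariesSP[G zG]|[m zm]].
  by exists (G (one n)); apply: etrans (zG _) _; rewrite -linearZ.
have [b [zb bz]] := cocycle_factor (submP z).
have [Psi [w [rho [_ yP]]]] := pow_syz_decomp n.
have GL : linear (fun r : R^o => (r : R) *: m).
  by move=> r s t; rewrite scalerDl scalerA.
(* For y = r *: pow_syz n + w (val y), b gives r x^n m + b (w (val y)), and r x^n = Psi (val y); so
   this G extends b. *)
pose G := (linmap GL \o Psi) \+ (b \o w).
apply/coboundariesSP; exists G => y.
have [r [yE _ PsiE]] := yP y.
rewrite -[LHS]bz [in LHS]yE linearP bz -[hom_fun _ _]/(eval1 z) zm.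
by rewrite scalerA -PsiE.
Qed.

(* In terms of the description of H^1 as the cokernel of M -> M_x,
   frac_class n m h says that h is the class of m / x^n. *)
Definition frac_class n m (h : local_cohomology a 1 M) :=
  exists l (z : C 1 l), [/\ (n <= l)%N, h = lc_class z &
    eval1 z = x ^+ (l - n) *: m].

Lemma frac_class_raise n m h : frac_class n m h ->
  exists k, forall l, (k <= l)%N -> exists z : C 1 l,
    [/\ (n <= l)%N, h = lc_class z & eval1 z = x ^+ (l - n) *: m].
Proof.
move=> [k [z [nk -> zm]]]; exists k => l kl; rewrite -(subnK kl).
have [z' [E zy]] := lc_class_trans (l - k) z; exists z'; split=> //.
  by rewrite (leq_trans nk) // leq_addl.
by rewrite (eval1_trans zy) zm scalerA -exprD addnBA.
Qed.

Lemma frac_classP n r m h m' h' : frac_class n m h -> frac_class n m' h' ->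
  frac_class n (r *: m + m') (r *: h + h').
Proof.
move=> /frac_class_raise[k kP] /frac_class_raise[k' kP'].
have [z [nl -> zm]] := kP _ (leq_maxl k k').
have [z' [_ -> zm']] := kP' _ (leq_maxr k k').
exists (maxn k k'), (r *: z + z'); split=> //; first by rewrite lc_classP.
by rewrite eval1P zm zm' scalerDr !scalerA mulrC.
Qed.

Lemma frac_class0 n h : frac_class n 0 h -> h = 0.
Proof.
move=> [l [z [_ -> zm]]]; apply: lc_class0; apply/eval1_exact; exists 0.
by rewrite zm !scaler0.
Qed.

Lemma frac_class_inj n m h h' : frac_class n m h -> frac_class n m h' -> h = h'.
Proof.
move=> H H'; apply/esym/subr0_eq.
have := frac_classP (-1) H H'; rewrite !scaleN1r addNr addrC.
exact: frac_class0.
Qed.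

Lemma frac_class_ex n m : exists h, frac_class n m h.
Proof.
(* Level c + n is used because rho sends [pow_syz] to x^c: the cocycle y |-> rho y *: m represents
   x^c m / x^(c+n) = m / x^n. *)
have [Psi [w [rho [rho1 yP]]]] := pow_syz_decomp (c + n).
have bL : linear (fun y : S (c + n) => (rho y : R) *: m).
  by move=> r s t; rewrite linearP scalerDl scalerA.
have [z zP] := cocycle_of_linear (n := 1) (N := L (c + n)) (linmap bL).
exists (lc_class z), (c + n)%N, z; split=> //; first exact: leq_addl.
by apply: etrans (zP _) _; rewrite addnK /= free_lift_basis rho1.
Qed.

Lemma frac_class_onto h : exists n m, frac_class n m h.
Proof.
have [n [z ->]] := lc_class_onto h.
by exists n, (eval1 z), n, z; rewrite subnn scale1r.
Qed.

Lemma frac_class_expand k n m h :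
  frac_class n m h -> frac_class (k + n) (x ^+ k *: m) h.
Proof.
move=> /frac_class_raise[l lP].
have [z [_ -> zm]] := lP _ (leq_maxl l (k + n)).
exists (maxn l (k + n)), z; split=> //; first exact: leq_maxr.
by rewrite zm scalerA -exprD subnDK // leq_maxr.
Qed.

Lemma frac_class_cancel k n m h :
  frac_class (k + n) (x ^+ k *: m) h -> frac_class n m h.
Proof.
move=> [l [z [nl -> zm]]]; exists l, z; split=> //.
  by rewrite (leq_trans _ nl) // leq_addl.
by rewrite zm scalerA -exprD subnDK.
Qed.

Lemma frac_class_scale n m h : frac_class n.+1 m h -> frac_class n m (x *: h).
Proof.
move=> H; have H0 : frac_class n.+1 0 0.
  have := frac_classP (-1) H H; by rewrite !scaleN1r !addNr.
apply: (@frac_class_cancel 1); rewrite expr1 add1n.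
by have := frac_classP x H H0; rewrite !addr0.
Qed.

Lemma lc1_divisible (h : local_cohomology a 1 M) : exists h', x *: h' = h.
Proof.
have [n [m nm]] := frac_class_onto h; have [h' h'P] := frac_class_ex n.+1 m.
by exists h'; apply: frac_class_inj nm; apply: frac_class_scale.
Qed.

Lemma lc1_kernel (h : local_cohomology a 1 M) :
  x *: h = 0 -> exists m, frac_class 1 m h.
Proof.
move=> xh; have [n [m nm]] := frac_class_onto h.
have H0 : frac_class n 0 0.
  by have := frac_classP (-1) nm nm; rewrite !scaleN1r !addNr.
have [l [z [nl /esym z0 zm]]] := frac_classP x nm H0.
rewrite xh !addr0 in z0 zm.
have [k [z' [/eval1_exact[m' z'm'] zy]]] := lc_class_eq0 z0.
(* With h = m / x^n, the vanishing of x h at level k + l makes its numerator x^(k+l) m'. Dividing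
   once more by x gives h = m' / x. *)
exists m'; have E : x ^+ (k + l) *: m' = x ^+ (k + (l - n)).+1 *: m.
  by rewrite -z'm' (eval1_trans zy) zm !scalerA -exprD -exprSr.
apply: (@frac_class_cancel (k + l)); rewrite E.
have -> : (k + l + 1 = (k + (l - n)).+1 + n)%N.
  by rewrite addn1 addSn -addnA subnK.
exact: frac_class_expand.
Qed.

Lemma lc1_kernel_weakly_laskerian : weakly_laskerian M ->
  weakly_laskerian (subm (ker (scale_map (local_cohomology a 1 M) x))).
Proof.
apply: (@weakly_laskerian_subquotient _ _ _
  (fun m h => frac_class 1 m (val h))).
- by move=> r m h m' h' mh mh'; rewrite linearP; apply: frac_classP.
- by move=> h; apply: lc1_kernel; exact: (submP h).
by move=> h /frac_class0 h0; apply: val_inj.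
Qed.
End PrincipalPowers.

(** * Weak cofiniteness in degrees 0, 1 and at least 2 *)

Theorem corollary3p3 (R : comPzRingType) (a : ideal R) (M : lmodType R) :
  noetherian R -> principal_ideal a -> weakly_laskerian M ->
  forall i : nat, weakly_cofinite a (local_cohomology a i M).
Proof.
move=> nR pa wM i.
have [x ax] : exists x : R, forall y, a y <-> span [set x : R^o] y by [].
have aP (y : R) : a y <-> exists r, y = r * x.
  rewrite ax; split=> [|[r ->] N Nx]; last by apply: submoduleZ; apply: Nx.
  have SP : is_submodule [set y : R^o | exists r : R, y = r * x].
    split=> [|s _ _ [r ->] [t ->]]; first by exists 0; rewrite mul0r.
    by exists (s * r + t); rewrite mulrDl -mulrA.
  by move=> /(_ (Submodule SP)); apply=> _ ->; exists 1; rewrite mul1r.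
have [c cP] := annihilators_stable x nR.
split; first exact: lc_support aP _ _.
move=> j; have fga := mquot_fg a.
case: i => [|[|i]].
- by apply: Ext_weakly_laskerian => //; exact: lc0_weakly_laskerian.
- apply: (@Ext_divisible_weakly_laskerian _ _ _ x).
  + move=> l; rewrite -[l]mquot_pi_surj -linearZ -(linear0 (mquot_pi _)).
    by apply/mquot_piP/aP; exists (repr l); rewrite subr0 mulrC.
  + exact: (lc1_divisible aP cP).
  apply: Ext_weakly_laskerian => //.
  exact: (lc1_kernel_weakly_laskerian aP cP).
apply: Ext_weakly_laskerian => //.
(* The always-true relation presents the zero module as a quotient of M. *)
apply: (@weakly_laskerian_subquotient _ _ _ (fun _ _ => True)) wM => //.
  by exists 0.
by move=> h _; apply: (lc_vanish aP cP).
Qed.
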